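(* Let $\mathcal{M}$ be a von Neumann algebra with underlying Hilbert space $H$. Let $a, b \in \mathcal{M}$ with $0 \le a, b \le 1$ be strict and absolutely compatible, and let $\mathcal{M}_1$ be the von Neumann subalgebra of $\mathcal{M}$ generated by $a$ and $b$. (1) There exist a halving projection $p \in \mathcal{M}$ and a unitary $U_0 : K \oplus K \to H$, where $K = pH$, such that $U_0^* \mathcal{M}_1 U_0$ is unitally $*$-isomorphic to $M_2(\mathcal{M}_0)$ for some abelian von Neumann algebra $\mathcal{M}_0$ acting on $K$. (2) (With $p$, $K$, $U_0$, $\mathcal{M}_0$ as in (1).) There exist a strict projection $P$ in $M_2(\mathcal{M}_0)$ and a strict element $x_0$ in $\mathcal{M}_0^+$ such that $$U_0^* a U_0 = \left((p - x_0) \otimes I_2 \right) P_0 + (x_0 \otimes I_2) P$$ and $$U_0^* b U_0 = \left((p - x_0) \otimes I_2 \right) P_0 + (x_0 \otimes I_2) P',$$ where $I_2 = \begin{bmatrix} p & 0 \\ 0 & p \end{bmatrix}$ is the unity of $M_2(\mathcal{M}_0)$, $P_0 = \begin{bmatrix} 0 & 0 \\ 0 & p \end{bmatrix} \in M_2(\mathcal{M}_0)$ and $P' = I_2 - P$.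
   Context: For a von Neumann algebra $\mathcal{N}$ with unity $1_{\mathcal{N}}$, $\mathcal{P}(\mathcal{N})$ denotes its set of projections. For $a \in \mathcal{N}$ with $0 \le a \le 1_{\mathcal{N}}$ put $s(a) := \sup\{q \in \mathcal{P}(\mathcal{N}) : q \le a\}$ and $n(a) := \sup\{q \in \mathcal{P}(\mathcal{N}) : q a = 0\}$; $a$ is called strict in $\mathcal{N}$ if $s(a) = 0$ and $n(a) = 0$. Elements $0 \le a, b \le 1_{\mathcal{N}}$ are absolutely compatible if $|a - b| + |1_{\mathcal{N}} - a - b| = 1_{\mathcal{N}}$, where $|x| = (x^*x)^{1/2}$. A projection $p \in \mathcal{M}$ is a halving projection if there is a partial isometry $u \in \mathcal{M}$ with $u^*u = p$ and $uu^* = 1 - p$. The unity of $\mathcal{M}_0$ is $p$ (the identity operator on $K = pH$). $M_2(\mathcal{M}_0)$ is the von Neumann algebra of $2\times 2$ matrices over $\mathcal{M}_0$, acting on $K \oplus K$, and $x \otimes I_2 = \begin{bmatrix} x & 0 \\ 0 & x \end{bmatrix}$ for $x \in \mathcal{M}_0$. For $\mathcal{M}_0$ abelian with unity $p$, a projection $P = \begin{bmatrix} p_1 & r \\ r^* & p_2 \end{bmatrix} \in M_2(\mathcal{M}_0)$ is a strict projection if $p_1$ is strict in $\mathcal{M}_0$ (with $p_1 \in \mathcal{M}_0^+$) and $p_1 + p_2 = p$. *)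

(* Defs.v *)
From HB Require Import structures.
From mathcomp Require Import all_boot all_order all_algebra.
From mathcomp Require Import sesquilinear.
From mathcomp Require Import boolp classical_sets functions reals topology normedtype.

Set Implicit Arguments.
Unset Strict Implicit.
Unset Printing Implicit Defensive.

Import Order.TTheory GRing.Theory Num.Def Num.Theory.
Import numFieldNormedType.Exports.

Local Open Scope classical_set_scope.
Local Open Scope ring_scope.

Section CauchySchwarz.
Variables (C : numClosedFieldType) (U : lmodType C) (f : {dot U for @conjC C}).

Lemma dot_CauchySchwarz (u v : U) : `|f u v| ^+ 2 <= f u u * f v v.
Proof.
have [->|v0] := eqVneq v 0; first by rewrite !linear0r normr0 expr0n mulr0.
have fv0 : 0 < f v v by rewrite dnorm_gt0.
have fvr : (f v v)^* = f v v by apply: geC0_conj; exact: ltW.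
have fvu : f v u = (f u v)^* by rewrite hermC expr0 mul1r.
set a := f u v / f v v.
have: 0 <= f (u - a *: v) (u - a *: v) by exact: dnorm_ge0.
have aC : conjC a = conjC (f u v) / f v v by rewrite rmorphM/= fmorphV/= fvr.
rewrite linearBl/= !linearBr/= !linearZl_LR/= !linearZr_LR/= aC fvu.
rewrite divfK ?gt_eqF// subrr subr0 subr_ge0 mulrAC ler_pdivrMr//.
by rewrite normCK mulrC.
Qed.

Lemma dot_triangle (u v : U) :
  sqrtC (f (u + v) (u + v)) <= sqrtC (f u u) + sqrtC (f v v).
Proof.
have h w : 0 <= sqrtC (f w w) by rewrite sqrtC_ge0 dnorm_ge0.
rewrite -ler_sqr ?nnegrE ?addr_ge0//.
rewrite sqrrD !sqrtCK addrAC dnormD lerD2l.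
apply: (@le_trans _ _ (`|f u v| *+ 2)).
  have := leif_Re_Creal (f u v); rewrite ReE => -[+ _].
  by rewrite ler_pdivrMr ?ltr0n// mulr_natr.
rewrite lerMn2r/= -ler_sqr ?nnegrE ?mulr_ge0//.
by rewrite exprMn !sqrtCK dot_CauchySchwarz.
Qed.


End CauchySchwarz.

(* The inner product is linear in the first argument and conjugate-linear in the
   second one. The structures are meant for [C := R[i]] with [R : realType]. *)
HB.mixin Record NormedModule_isPreHilbert (C : numClosedFieldType) H
    & NormedModule C H := {
  inner : {dot H for @conjC C} ;
  inner_norm : forall x : H, inner x x = `|x| ^+ 2
}.

#[short(type="preHilbertType")]
HB.structure Definition PreHilbert (C : numClosedFieldType) :=
  {H of NormedModule C H & NormedModule_isPreHilbert C H}.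

#[short(type="hilbertType")]
HB.structure Definition Hilbert (C : numClosedFieldType) :=
  {H of PreHilbert C H & Complete H}.

HB.factory Record Lmodule_isPreHilbert (C : numClosedFieldType) H
    & GRing.Lmodule C H := {
  dotf : {dot H for @conjC C}
}.

HB.builders Context C H & Lmodule_isPreHilbert C H.

Let norm (x : H) : C := sqrtC (dotf x x).

Let ler_normD x y : norm (x + y) <= norm x + norm y.
Proof. exact: dot_triangle. Qed.

Let normrZ (l : C) x : norm (l *: x) = `|l| * norm x.
Proof.
by rewrite /norm dnormZ sqrtCM ?nnegrE ?exprn_ge0// sqrCK.
Qed.

Let normr0_eq0 x : norm x = 0 -> x = 0.
Proof. by move=> /eqP; rewrite sqrt_dnorm_eq0 => /eqP. Qed.

HB.instance Definition _ :=
  Lmodule_isNormed.Build C H ler_normD normrZ normr0_eq0.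

Let dotf_norm (x : H) : dotf x x = `|x| ^+ 2.
Proof. by rewrite [RHS]sqrtCK. Qed.

HB.instance Definition _ := NormedModule_isPreHilbert.Build C H dotf_norm.

HB.end.

Section bop.
Context {C : numClosedFieldType}.

Definition bounded_linear (U V : normedModType C) : {pred U -> V} :=
  mem [set f : U -> V | linear f /\ continuous f].
Arguments bounded_linear : clear implicits.

Lemma bounded_linear_submod (U V : normedModType C) :
  submod_closed (bounded_linear U V).
Proof.
split; first by rewrite inE; split=> [a x y|]; [rewrite scaler0 addr0|exact: cst_continuous].
move=> a f g /[!inE] -[lf cf] [lg cg]; split.
  move=> b x y; rewrite !fctE lf lg !scalerDr addrACA; congr (_ + (_ + _)) => //.
  by rewrite !scalerA mulrC.
by move=> x; exact: (cvgD (cvgZ (cvg_cst a) (cf x)) (cg x)).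
Qed.

HB.instance Definition _ (U V : normedModType C) :=
  GRing.isSubmodClosed.Build C (U -> V) (bounded_linear U V)
    (bounded_linear_submod U V).

(* Bounded operators: for linear maps, bounded and continuous are equivalent
   ([linear_bounded_continuous]). *)
Record bop (U V : normedModType C) := Bop {
  bop_fun :> U -> V ;
  bopP : bop_fun \in bounded_linear U V
}.

HB.instance Definition _ (U V : normedModType C) := [isSub for @bop_fun U V].
HB.instance Definition _ (U V : normedModType C) :=
  [Choice of bop U V by <:].
HB.instance Definition _ (U V : normedModType C) :=
  [SubChoice_isSubLmodule of bop U V by <:].

Lemma bop_linear (U V : normedModType C) (f : bop U V) : linear f.
Proof. by have := bopP f; rewrite inE => -[]. Qed.

Lemma bop_continuous (U V : normedModType C) (f : bop U V) : continuous f.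
Proof. by have := bopP f; rewrite inE => -[]. Qed.

HB.instance Definition _ (U V : normedModType C) (f : bop U V) :=
  GRing.isLinear.Build C U V *:%R f (bop_linear f).

Lemma bop_ext (U V : normedModType C) (f g : bop U V) : f =1 g -> f = g.
Proof. by move=> fg; apply/val_inj/funext. Qed.

Lemma bounded_linear_comp (U V W : normedModType C)
  (g : bop V W) (f : bop U V) : g \o f \in bounded_linear U W.
Proof.
rewrite inE; split; first by move=> a x y /=; rewrite !linearP.
by move=> x; apply: continuous_comp; apply: bop_continuous.
Qed.

Definition bcomp (U V W : normedModType C) (g : bop V W) (f : bop U V) :
  bop U W := Bop (bounded_linear_comp g f).

Lemma bounded_linear_id (U : normedModType C) : id \in bounded_linear U U.
Proof. by rewrite inE; split=> // x; exact: cvg_id. Qed.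

Definition bid (U : normedModType C) : bop U U := Bop (bounded_linear_id U).

Section bop_ring.
Variable U : normedModType C.

Let bcompA : associative (@bcomp U U U).
Proof. by move=> f g h; exact: bop_ext. Qed.
Let bcomp1l : left_id (bid U) (@bcomp U U U).
Proof. by move=> f; exact: bop_ext. Qed.
Let bcomp1r : right_id (bid U) (@bcomp U U U).
Proof. by move=> f; exact: bop_ext. Qed.
Let bcompDl : left_distributive (@bcomp U U U) +%R.
Proof. by move=> f g h; exact: bop_ext. Qed.
Let bcompDr : right_distributive (@bcomp U U U) +%R.
Proof. by move=> f g h; apply: bop_ext => x /=; exact: linearD. Qed.

HB.instance Definition _ := GRing.Zmodule_isPzRing.Build (bop U U)
  bcompA bcomp1l bcomp1r bcompDl bcompDr.
End bop_ring.

Lemma bounded_linear_contract (U V : normedModType C) (f : U -> V) :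
  linear f -> (forall x, `|f x| <= `|x|) -> f \in bounded_linear U V.
Proof.
move=> lf fle; rewrite inE; split=> // x.
apply/cvgrPdist_lt => e e0; near=> t.
have -> : f x - f t = f (x - t).
  by rewrite addrC -scaleN1r -lf scaleN1r addrC.
by apply: le_lt_trans (fle _) _; near: t; exact: cvgr_dist_lt.
Unshelve. all: by end_near. Qed.

Lemma cauchy_contract (U V : normedModType C) (f : U -> V)
    (F : set_system U) : Filter F ->
  linear f -> (forall x, `|f x| <= `|x|) -> cauchy F -> cauchy (f @ F).
Proof.
move=> FF lf fle /cauchy_ballP Fc; apply/cauchy_ballP => e e0.
have [[A B] /= [FA FB] AB] := Fc e e0.
exists (f @` A, f @` B) => /=.
  by split; [apply: filterS FA|apply: filterS FB] => x; exists x.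
move=> [_ _] [/= [x Ax <-] [y By <-]].
have /= := AB (x, y) (conj Ax By); rewrite -!ball_normE /=; apply: le_lt_trans.
have -> : f x - f y = f (x - y).
  by rewrite addrC -scaleN1r -lf scaleN1r addrC.
exact: fle.
Qed.
End bop.
Arguments bounded_linear {C} U V.
Notation "g \bo f" := (bcomp g f) (at level 40, left associativity) : ring_scope.

Section pspace.
Context {C : numClosedFieldType}.

(* The Hilbert space pH. It is defined as the space of vectors fixed by [p], which
   is closed for every [p], and is the range of [p] when [p] is a projection
   (lemma [pspace_range] below). *)
Record pspace (H : hilbertType C) (p : bop H H) := PSpace {
  pval :> H ;
  pvalP : p pval == pval
}.
Arguments pval {H p}.

Variables (H : hilbertType C) (p : bop H H).

Definition pfix : {pred H} := [pred x | p x == x].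

Lemma pfix_submod : submod_closed pfix.
Proof.
split; first by rewrite inE linear0.
by move=> a x y /[!inE] /eqP px /eqP py; rewrite linearP/= px py.
Qed.

HB.instance Definition _ := GRing.isSubmodClosed.Build C H pfix pfix_submod.
HB.instance Definition _ : isSub H pfix (pspace p) := [isSub for @pval H p].
HB.instance Definition _ := [Choice of pspace p by <:].
HB.instance Definition _ := [SubChoice_isSubLmodule of pspace p by <:].

Definition pinner (x y : pspace p) : C := inner (pval x) (pval y).

Let pinnerP : bilinear_for *%R ( @conjC C \; *%R) pinner.
Proof.
split=> [y a x1 x2|x a y1 y2]; rewrite /pinner.
  by rewrite linearPl.
by rewrite linearPr.
Qed.

HB.instance Definition _ := bilinear_isBilinear.Build C (pspace p) (pspace p) C
  *%R ( @conjC C \; *%R) pinner pinnerP.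


Let pinner_herm x y : pinner x y = (-1) ^+ false * conjC (pinner y x).
Proof. by rewrite /pinner hermC. Qed.

HB.instance Definition _ := isHermitianSesquilinear.Build C (pspace p)
  false ( @conjC C) pinner pinner_herm.

Let pinner_gt0 (x : pspace p) : x != 0 -> 0 < pinner x x.
Proof. by move=> x0; rewrite /pinner dnorm_gt0. Qed.

HB.instance Definition _ := isDotProduct.Build C (pspace p) pinner pinner_gt0.

HB.instance Definition _ := Lmodule_isPreHilbert.Build C (pspace p)
  (pinner : {dot (pspace p) for @conjC C}).

Lemma pval_norm (x : pspace p) : `|pval x| = `|x|.
Proof.
apply/eqP; rewrite -(@eqrXn2 _ 2)// -!inner_norm; exact/eqP.
Qed.

Let pspace_complete (F : set_system (pspace p)) :
  ProperFilter F -> cauchy F -> cvg F.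
Proof.
move=> FF Fc.
have /cvg_ex[/= l Fl] : cvg (pval @ F).
  apply: cauchy_cvg; apply: cauchy_contract => // x; by rewrite pval_norm.
have pl : p l == l.
  have pFl : p \o pval @ F --> p l.
    by apply: cvg_comp Fl _; exact: bop_continuous.
  have pE : p \o pval = @pval H p.
    by apply/funext => x /=; apply/eqP; exact: pvalP.
  by rewrite pE in pFl; apply/eqP; apply: cvg_unique pFl Fl.
apply/cvg_ex; exists (PSpace pl); apply/cvgrPdist_lt => e e0.
by near=> x; rewrite -pval_norm; near: x; exact: (cvgrPdist_lt _ _).1 Fl e e0.
Unshelve. all: by end_near. Qed.


HB.instance Definition _ := Uniform_isComplete.Build (pspace p) pspace_complete.

End pspace.

(* An alias of the product, so as to carry the Hilbert sum norm
   (|x|^2 + |y|^2)^(1/2) instead of the library's sup norm on [K * L]. *)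
Definition dsum (C : numClosedFieldType) (K L : lmodType C) := (K * L)%type.

Section dsum.
Context {C : numClosedFieldType}.

HB.instance Definition _ (K L : lmodType C) :=
  GRing.Lmodule.copy (dsum K L) (K * L)%type.

Variables (K L : hilbertType C).

Definition dinner (x y : dsum K L) : C := inner x.1 y.1 + inner x.2 y.2.

Let dinnerP : bilinear_for *%R ( @conjC C \; *%R) dinner.
Proof.
split=> [y a x1 x2|x a y1 y2]; rewrite /dinner /=.
  by rewrite !linearPl mulrDr addrACA.
by rewrite !linearPr mulrDr addrACA.
Qed.

HB.instance Definition _ := bilinear_isBilinear.Build C (dsum K L) (dsum K L) C
  *%R ( @conjC C \; *%R) dinner dinnerP.

Let dinner_herm x y : dinner x y = (-1) ^+ false * conjC (dinner y x).
Proof.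
by rewrite /dinner hermC [in X in _ + X]hermC !expr0 !mul1r rmorphD.
Qed.

HB.instance Definition _ := isHermitianSesquilinear.Build C (dsum K L)
  false ( @conjC C) dinner dinner_herm.

Let dinner_gt0 (x : dsum K L) : x != 0 -> 0 < dinner x x.
Proof.
move=> x0; rewrite /dinner lt_def addr_ge0 ?dnorm_ge0// andbT.
apply: contra x0; rewrite paddr_eq0 ?dnorm_ge0// !dnorm_eq0.
by case: x => u v /= /andP[/eqP-> /eqP->].
Qed.

HB.instance Definition _ := isDotProduct.Build C (dsum K L) dinner dinner_gt0.

HB.instance Definition _ := Lmodule_isPreHilbert.Build C (dsum K L)
  (dinner : {dot (dsum K L) for @conjC C}).

Lemma dsum_norm (x : dsum K L) : `|x| ^+ 2 = `|x.1| ^+ 2 + `|x.2| ^+ 2.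
Proof. by rewrite -!inner_norm. Qed.

Lemma dsum_norm_fst (x : dsum K L) : `|x.1| <= `|x|.
Proof. by rewrite -ler_sqr ?nnegrE// dsum_norm lerDl exprn_ge0. Qed.

Lemma dsum_norm_snd (x : dsum K L) : `|x.2| <= `|x|.
Proof. by rewrite -ler_sqr ?nnegrE// dsum_norm lerDr exprn_ge0. Qed.

Lemma dsum_norm_le (x : dsum K L) : `|x| <= `|x.1| + `|x.2|.
Proof.
rewrite -ler_sqr ?nnegrE ?addr_ge0// dsum_norm sqrrD addrAC lerDl.
by rewrite mulrn_wge0// mulr_ge0.
Qed.

Let dsum_complete (F : set_system (dsum K L)) :
  ProperFilter F -> cauchy F -> cvg F.
Proof.
move=> FF Fc.
have /cvg_ex[/= k Fk] : cvg ((fun x : dsum K L => x.1) @ F).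
  by apply: cauchy_cvg; apply: cauchy_contract => //; exact: dsum_norm_fst.
have /cvg_ex[/= l Fl] : cvg ((fun x : dsum K L => x.2) @ F).
  by apply: cauchy_cvg; apply: cauchy_contract => //; exact: dsum_norm_snd.
apply/cvg_ex; exists ((k, l) : dsum K L); apply/cvgrPdist_lt => e e0.
have e20 : 0 < e / 2 by rewrite divr_gt0.
near=> x; apply: le_lt_trans (dsum_norm_le _) _.
rewrite [e]splitr ltrD//; near: x.
  exact: (cvgrPdist_lt _ _).1 Fk _ e20.
exact: (cvgrPdist_lt _ _).1 Fl _ e20.
Unshelve. all: by end_near. Qed.


HB.instance Definition _ := Uniform_isComplete.Build (dsum K L) dsum_complete.

Lemma dfst_bounded_linear :
  (fun x : dsum K L => x.1) \in bounded_linear (dsum K L) K.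
Proof. by apply: bounded_linear_contract => // x; exact: dsum_norm_fst. Qed.

Lemma dsnd_bounded_linear :
  (fun x : dsum K L => x.2) \in bounded_linear (dsum K L) L.
Proof. by apply: bounded_linear_contract => // x; exact: dsum_norm_snd. Qed.

Lemma dinl_bounded_linear :
  (fun x : K => (x, 0) : dsum K L) \in bounded_linear K (dsum K L).
Proof.
apply: bounded_linear_contract => [a x y|x].
  by apply: injective_projections; rewrite /= ?scaler0 ?addr0.
by rewrite -ler_sqr ?nnegrE// dsum_norm normr0 expr0n addr0.
Qed.

Lemma dinr_bounded_linear :
  (fun x : L => (0, x) : dsum K L) \in bounded_linear L (dsum K L).
Proof.
apply: bounded_linear_contract => [a x y|x].
  by apply: injective_projections; rewrite /= ?scaler0 ?addr0.
by rewrite -ler_sqr ?nnegrE// dsum_norm normr0 expr0n add0r.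
Qed.

Definition dfst := Bop dfst_bounded_linear.
Definition dsnd := Bop dsnd_bounded_linear.
Definition dinl := Bop dinl_bounded_linear.
Definition dinr := Bop dinr_bounded_linear.

End dsum.

(* [x y; z w] acting on K (+) L by column vectors. *)
Definition block (C : numClosedFieldType) (K L : hilbertType C)
    (x : bop K K) (y : bop L K) (z : bop K L) (w : bop L L) :
    bop (dsum K L) (dsum K L) :=
  dinl K L \bo (x \bo dfst K L + y \bo dsnd K L) +
  dinr K L \bo (z \bo dfst K L + w \bo dsnd K L).

Lemma blockE (C : numClosedFieldType) (K L : hilbertType C)
    (x : bop K K) (y : bop L K) (z : bop K L) (w : bop L L) k l :
  block x y z w (k, l) = (x k + y l, z k + w l).
Proof. by apply: injective_projections; rewrite /= ?addr0 ?add0r. Qed.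

Section operators.
Context {C : numClosedFieldType}.
Implicit Types H K : hilbertType C.

(* Such a [g] exists by the Riesz representation theorem and is unique, so the
   default value 0 is never used. *)
Definition adj H K (f : bop H K) : bop K H :=
  xget 0 [set g : bop K H | forall x y, inner (f x) y = inner x (g y)].

(* [0 <= z] for a complex [z] says that [z] is real and nonnegative. *)
Definition positive H (f : bop H H) := forall x, 0 <= inner (f x) x.

Definition ople H (f g : bop H H) := positive (g - f).

(* The unique positive square root of [adj f * f]. *)
Definition oabs H (f : bop H H) : bop H H :=
  xget 0 [set g : bop H H | positive g /\ g * g = adj f * f].

Definition projection H (p : bop H H) := p * p = p /\ adj p = p.

Definition partial_isometry H (u : bop H H) := projection (adj u * u).

Definition unitary H K (u : bop H K) :=
  adj u \bo u = bid H /\ u \bo adj u = bid K.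

Definition commutant H (S : set (bop H H)) : set (bop H H) :=
  [set y | forall x, S x -> x * y = y * x].

Definition star_subalgebra H (M : set (bop H H)) :=
  [/\ M 1,
      forall (c : C) x y, M x -> M y -> M (c *: x + y),
      forall x y, M x -> M y -> M (x * y) &
      forall x, M x -> M (adj x)].

(* The unit of a von Neumann algebra acting on [H] is the identity of [H]. *)
Definition von_neumann H (M : set (bop H H)) :=
  star_subalgebra M /\ commutant (commutant M) = M.

Definition abelian H (M : set (bop H H)) :=
  forall x y, M x -> M y -> x * y = y * x.

Definition vN_generated H (M S : set (bop H H)) : set (bop H H) :=
  [set x | forall N, von_neumann N -> N `<=` M -> S `<=` N -> N x].

Definition effect H (N : set (bop H H)) (a : bop H H) :=
  [/\ N a, ople 0 a & ople a 1].

Definition projections H (N : set (bop H H)) : set (bop H H) :=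
  [set q | N q /\ projection q].

(* [q] is the supremum, among the projections of [N], of the set [S]. *)
Definition is_psup H (N S : set (bop H H)) (q : bop H H) :=
  [/\ projections N q,
      forall r, S r -> ople r q &
      forall q', projections N q' -> (forall r, S r -> ople r q') -> ople q q'].

(* s(a) = 0 and n(a) = 0; it is only used for [effect N a]. *)
Definition strict H (N : set (bop H H)) (a : bop H H) :=
  is_psup N [set q | projections N q /\ ople q a] 0 /\
  is_psup N [set q | projections N q /\ q * a = 0] 0.

Definition absolutely_compatible H (a b : bop H H) :=
  oabs (a - b) + oabs (1 - a - b) = 1.

Definition halving_projection H (M : set (bop H H)) (p : bop H H) :=
  [/\ M p, projection p &
      exists2 u, M u &
        [/\ partial_isometry u, adj u * u = p & u * adj u = 1 - p]].

(* Unital *-isomorphism; only the values of [f] on [A] matter. *)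
Definition star_isomorphic H K (A : set (bop H H)) (B : set (bop K K)) :=
  exists f : bop H H -> bop K K,
    [/\ set_bij A B f,
        f 1 = 1,
        forall (c : C) x y, A x -> A y -> f (c *: x + y) = c *: f x + f y,
        forall x y, A x -> A y -> f (x * y) = f x * f y &
        forall x, A x -> f (adj x) = adj (f x)].

Definition M2 K (N : set (bop K K)) : set (bop (dsum K K) (dsum K K)) :=
  [set T | exists x y z w, [/\ N x, N y, N z, N w & T = block x y z w]].

(* x (x) I_2 *)
Definition ampl K (x : bop K K) := block x 0 0 x.

Definition strict_projection K (N : set (bop K K))
    (P : bop (dsum K K) (dsum K K)) :=
  projection P /\
  exists p1 r p2, [/\ P = block p1 r (adj r) p2,
    [/\ N p1, N r & N p2], effect N p1, strict N p1 & p1 + p2 = 1].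

Lemma pspace_range H (p : bop H H) : projection p ->
  range (@pval C H p) = range p.
Proof.
move=> [pp _]; apply/seteqP; split=> [_ [x _ <-]|_ [x _ <-]].
  by exists (pval x) => //; apply/eqP; exact: pvalP.
have pxP : p (p x) == p x by rewrite -[in X in _ == X]pp.
by exists (PSpace pxP).
Qed.

End operators.

(* Main.v *)
From HB Require Import structures.
Require Import Defs.
From mathcomp Require Import all_boot all_order all_algebra.
From mathcomp Require Import ring lra.
From mathcomp.real_closed Require Import complex.
From mathcomp Require Import sesquilinear.
From mathcomp Require Import boolp classical_sets functions reals topology normedtype.

Set Implicit Arguments.
Unset Strict Implicit.
Unset Printing Implicit Defensive.

Import Order.TTheory GRing.Theory Num.Def Num.Theory.
Import numFieldNormedType.Exports.
Local Open Scope classical_set_scope.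
Local Open Scope ring_scope.

(** Put [x = a - b], [y = 1 - a - b] and [c = |x|], so that absolute compatibility
    says [|y| = 1 - c].  The modulus [c] commutes with [x], and [1 - c] commutes with
    [y]; hence [c] commutes with [x] and [y], that is, with [a] and [b], and is
    central in the algebra they generate.  Strictness of [a] is injectivity of [a]
    and [1 - a] ([strictP]), because kernel projections of elements of the
    algebra belong to it; it forces [c] and [1 - c] to be injective
    ([abs_compat_ker]).  The polar decompositions of self-adjoint operators with
    injective modulus ([signP]) then give symmetries [s] and [t] with [x = c s] and
    [y = (1 - c) t], so
      [a = (1 - c) (1 - t)/2 + c (1 + s)/2],
      [b = (1 - c) (1 - t)/2 + c (1 - s)/2].
    A joint eigenvector of [s] and [t] would lie in the kernel of one of [a], [1 - a],
    [b], [1 - b]; so there is none ([abs_compat_decomposition]).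

    Two symmetries without joint eigenvectors are in generic position
    ([two_symmetries]).  The self-adjoint operator [m = i(st - ts)] is injective,
    satisfies [m^2 = 4 - E^2] for the central element [E = st + ts], and
    anticommutes with [t].  Its sign [q] is a symmetry that anticommutes with [t],
    so it exchanges the eigenprojection [p = (1 + t)/2] of [t] with [1 - p]: this
    is the halving projection, and [U (k, l) = k + q l] is the unitary from the sum
    of two copies of [pH] onto [H].

    An operator commuting with [p] and [q] is diagonal with equal entries for this
    decomposition, while [t] becomes [diag (1, -1)] and [q] the flip.  Let [x0], [e],
    [f] be the corners of [c], [E] and [g = |m|].  From [2 s = E t - i g q t] the
    matrix of [(1 + s)/2] is the projection [P] with diagonal [1/2 + e/4],
    [1/2 - e/4] and off-diagonal entries [i f/4], [- i f/4]; strictness of its first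
    entry is injectivity of [4 - E^2 = g^2].  The coefficient algebra is the
    bicommutant of [x0] and [e].  The commutant of [a] and [b] consists of the
    diagonal matrices [z (+) z] with [z] commuting with [x0] and [e]
    ([commutant_ab]), so taking commutants once more the algebra generated by [a]
    and [b] is carried onto all two-by-two matrices over the coefficient algebra
    ([generated_algebraE]).

    The functional analysis rests on three constructions: adjoints come from the
    Riesz theorem by minimizing a quadratic functional, square roots are limits of
    the iteration [y' = (z + y^2)/2] dominated by the same iteration on numbers,
    and kernel projections are [i i*] for the inclusion [i] of the kernel. *)

(** * Inner products and norms with real values *)

Section HilbertBasics.
Variable R : realType.
Local Notation C := R[i].
Implicit Types H K L : hilbertType C.

Lemma innerDl H (x y z : H) : inner (x + y) z = inner x z + inner y z.
Proof. exact: linearDl. Qed.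
Lemma innerDr H (x y z : H) : inner z (x + y) = inner z x + inner z y.
Proof. exact: linearDr. Qed.
Lemma innerNl H (x z : H) : inner (- x) z = - inner x z.
Proof. exact: linearNl. Qed.
Lemma innerNr H (x z : H) : inner z (- x) = - inner z x.
Proof. exact: linearNr. Qed.
Lemma innerZl H (a : C) (x z : H) : inner (a *: x) z = a * inner x z.
Proof. exact: linearZl_LR. Qed.
Lemma innerZr H (a : C) (x z : H) : inner z (a *: x) = conjC a * inner z x.
Proof. exact: linearZr_LR. Qed.
Lemma inner0l H (z : H) : inner 0 z = 0.
Proof. exact: linear0l. Qed.
Lemma inner0r H (z : H) : inner z 0 = 0.
Proof. exact: linear0r. Qed.
Lemma innerC H (x y : H) : inner x y = conjC (inner y x).
Proof. by rewrite hermC expr0 mul1r. Qed.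
Lemma inner_ge0 H (x : H) : 0 <= inner x x.
Proof. exact: dnorm_ge0. Qed.
Lemma inner_eq0 H (x : H) : inner x x = 0 -> x = 0.
Proof. by move=> /eqP; rewrite dnorm_eq0 => /eqP. Qed.

(** The norm of the space takes values in the partially ordered field [C]; its real
    part lives in a complete ordered field, where infima and estimates make sense. *)
Definition rnorm H (x : H) : R := complex.Re `|x|.

Lemma rnormE H (x : H) : `|x| = (rnorm x)%:C%C.
Proof. by rewrite /rnorm RRe_real// normr_real. Qed.
Lemma inner_rnorm H (x : H) : inner x x = (rnorm x ^+ 2)%:C%C.
Proof. by rewrite inner_norm rnormE rmorphXn. Qed.
Lemma rnorm_ge0 H (x : H) : 0 <= rnorm x.
Proof. by rewrite -ler0c -rnormE. Qed.
Lemma rnormD H (x y : H) : rnorm (x + y) <= rnorm x + rnorm y.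
Proof. by rewrite -lecR rmorphD/= -!rnormE ler_normD. Qed.
Lemma rnormN H (x : H) : rnorm (- x) = rnorm x.
Proof. by rewrite /rnorm normrN. Qed.
Lemma rnormZ H (a : C) (x : H) : rnorm (a *: x) = complex.Re `|a| * rnorm x.
Proof. by apply: complexI; rewrite rmorphM/= -rnormE normrZ rnormE. Qed.
Lemma rnormZr H (a : R) (x : H) : 0 <= a -> rnorm (a%:C%C *: x) = a * rnorm x.
Proof. by move=> a0; rewrite rnormZ ger0_norm // ler0c. Qed.
Lemma rnorm0 H : rnorm (0 : H) = 0.
Proof. by rewrite /rnorm normr0. Qed.
Lemma rnorm_eq0 H (x : H) : rnorm x = 0 -> x = 0.
Proof. by move=> x0; apply/normr0_eq0; rewrite rnormE x0. Qed.

Lemma Re_inner_le H (x y : H) : complex.Re (inner x y) <= rnorm x * rnorm y.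
Proof.
have : `|inner x y| <= (rnorm x * rnorm y)%:C%C.
  rewrite -(@ler_pXn2r _ 2) ?nnegrE//; last by rewrite ler0c mulr_ge0 ?rnorm_ge0.
  by rewrite (le_trans (dot_CauchySchwarz inner x y))// !inner_rnorm -rmorphM/= -exprMn rmorphXn.
move=> h; rewrite -lecR; apply: le_trans h; apply: le_trans (normc_ge_Re _).
by rewrite lecR ler_norm.
Qed.

Lemma inner_ext H (x y : H) : (forall z, inner x z = inner y z) -> x = y.
Proof.
move=> h; apply/eqP; rewrite -subr_eq0; apply/eqP/inner_eq0.
by rewrite innerDl innerNl h subrr.
Qed.

Lemma bop_inner_ext H K (f g : bop H K) :
  (forall x y, inner (f x) y = inner (g x) y) -> f = g.
Proof. by move=> h; apply: bop_ext => x; apply: inner_ext => y. Qed.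

(** Completeness for sequences, with real epsilons instead of filters. *)
Lemma complete_seq H (u : nat -> H) :
  (forall e : R, 0 < e -> exists N : nat, forall m n, (N <= m)%N -> (N <= n)%N ->
     rnorm (u m - u n) < e) ->
  exists l, forall e : R, 0 < e -> exists N : nat, forall n, (N <= n)%N ->
     rnorm (u n - l) < e.
Proof.
move=> uc.
have /cvg_ex[/= l ul] : cvg (u @ \oo).
  apply/cauchy_cvgP/cauchyP => e e0.
  have er : e = (complex.Re e)%:C%C by rewrite RRe_real// gtr0_real.
  have [N uN] := uc (complex.Re e) ltac:(by rewrite -ltcR -er).
  exists (u N); exists N => // n /= Nn.
  by rewrite -ball_normE /ball_ /= rnormE er ltcR uN.
exists l => e e0.
have /cvgrPdist_lt /(_ e%:C%C) := ul.
rewrite ltcR => /(_ e0) [N _ uN]; exists N => n Nn.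
by rewrite -rnormN opprB -ltcR -rnormE; exact: (uN n).
Qed.

Lemma bop_bounded H K (f : bop H K) :
  exists2 B : R, 0 < B & forall x, rnorm (f x) <= B * rnorm x.
Proof.
have /linear_boundedP : bounded_near f (nbhs (0 : H)).
  by apply: continuous_linear_bounded; exact: bop_continuous.
move=> [M [Mr fM]].
pose B := `|complex.Re M| + 1.
have MB : M < B%:C%C.
  rewrite -(RRe_real Mr) ltcR /B; have := ler_norm (complex.Re M); lra.
exists B; first by rewrite /B; have := normr_ge0 (complex.Re M); lra.
by move=> x; rewrite -lecR rmorphM/= -!rnormE; exact: fM.
Qed.

Lemma bounded_linear_of_le H K (f : H -> K) (B : R) : linear f ->
  (forall x, rnorm (f x) <= B * rnorm x) -> f \in bounded_linear H K.
Proof.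
move=> lf fB; rewrite inE; split => // x.
pose fl := GRing.isLinear.Build _ _ _ _ f lf.
pose F : {linear H -> K} := HB.pack f fl.
have /= : continuous F; last exact.
apply: bounded_linear_continuous; apply/linear_boundedP.
exists B%:C%C; split; first by rewrite complex_real.
move=> r Br y; apply: le_trans (_ : B%:C%C * `|y| <= _).
  by rewrite !rnormE -rmorphM/= lecR fB.
by rewrite ler_wpM2r // ltW.
Qed.

End HilbertBasics.

(** * The Riesz theorem and adjoints *)

Section Riesz.
Variable R : realType.
Local Notation C := R[i].
Implicit Types H K L : hilbertType C.

Lemma rnorm_sqr H (x : H) : rnorm x ^+ 2 = complex.Re (inner x x).
Proof. by rewrite inner_rnorm. Qed.

Lemma ReD (x y : C) : complex.Re (x + y) = complex.Re x + complex.Re y.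
Proof. by case: x y => ? ? []. Qed.
Lemma ReN (x : C) : complex.Re (- x) = - complex.Re x.
Proof. by case: x. Qed.
Lemma ReZ (a : R) (x : C) : complex.Re (a%:C%C * x) = a * complex.Re x.
Proof. by case: x => u v /=; rewrite mul0r subr0. Qed.
Lemma Re_inner_sym H (x y : H) : complex.Re (inner y x) = complex.Re (inner x y).
Proof. by rewrite innerC; case: (inner x y). Qed.

Lemma rnorm_sqrD H (x y : H) :
  rnorm (x + y) ^+ 2 = rnorm x ^+ 2 + rnorm y ^+ 2 + 2 * complex.Re (inner x y).
Proof. rewrite !rnorm_sqr innerDl !innerDr !ReD (Re_inner_sym x y); ring. Qed.

(** First-order condition at a minimum: for small [t] the linear term dominates. *)
Lemma quad_slope_ge0 (D N : R) : 0 <= N ->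
  (forall t : R, 0 < t -> 0 <= 2 * t * D + t ^+ 2 * N) -> 0 <= D.
Proof.
move=> N0 h; rewrite leNgt; apply/negP => D0.
have N1 : 0 < N + 1 by lra.
have t0 : 0 < - D / (N + 1) by rewrite divr_gt0// oppr_gt0.
have := h _ t0; set t := - D / (N + 1) in t0 *.
have tN : t * (N + 1) = - D by rewrite /t divfK// gt_eqF.
nra.
Qed.

(** [J x = |x|^2 - 2 Re (phi x)] is bounded below, and by the parallelogram
    identity any minimizing sequence is Cauchy.  Its limit [l] satisfies the
    first-order condition [Re <v, l> = Re (phi v)] for all [v]; replacing [v] by
    [i v] gives the imaginary part. *)
Lemma Riesz H (phi : H -> C) (B : R) :
  (forall x y, phi (x + y) = phi x + phi y) ->
  (forall (a : C) x, phi (a *: x) = a * phi x) ->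
  (forall x, complex.Re (phi x) <= B * rnorm x) ->
  exists z, forall x, phi x = inner x z.
Proof.
move=> phiD phiZ phiB.
pose J x : R := rnorm x ^+ 2 - 2 * complex.Re (phi x).
pose E : set R := range J.
have lbE : lbound E (- B ^+ 2).
  move=> _ [x _ <-]; rewrite /J; have := phiB x; have := rnorm_ge0 x.
  have := sqr_ge0 (rnorm x - B); nra.
have Einf : has_inf E by split; [exists (J 0); exists 0|exists (- B ^+ 2)].
have JI x : inf E <= J x by apply: ge_inf; [case: Einf|exists x].
have /choice[u uI] : forall n : nat, exists x, J x < inf E + n.+1%:R^-1.
  move=> n; have n0 : 0 < n.+1%:R^-1 :> R by rewrite invr_gt0 ltr0n.
  have [_ [x _ <-] xI] := inf_adherent n0 Einf.
  by exists x.
have small (e : R) : 0 < e -> exists N : nat, forall n, (N <= n)%N ->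
    n.+1%:R^-1 < e.
  move=> e0; have [N] := ltr_add_invr e0; rewrite add0r => Ne.
  exists N => n Nn; apply: le_lt_trans Ne.
  by rewrite lef_pV2 ?posrE ?ltr0n// ler_nat.
have mid x y : rnorm (x - y) ^+ 2 <= 2 * (J x - inf E) + 2 * (J y - inf E).
  have := JI (2^-1%:C%C *: (x + y)).
  rewrite /J rnormZr ?invr_ge0// phiZ ReZ phiD ReD exprMn.
  rewrite !rnorm_sqrD rnormN innerNr ReN; lra.
have [|l ul] := @complete_seq _ _ u.
  move=> e e0; have e2 : 0 < e ^+ 2 / 4 by rewrite divr_gt0// exprn_gt0.
  have [N uN] := small _ e2; exists N => m n Nm Nn.
  rewrite -(@ltr_pXn2r _ 2) ?nnegrE ?rnorm_ge0 ?(ltW e0)//.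
  apply: le_lt_trans (mid _ _) _.
  have := uI m; have := uI n; have := uN _ Nm; have := uN _ Nn.
  move: (J (u m)) (J (u n)) (m.+1%:R^-1) (n.+1%:R^-1) => ? ? ? ?; lra.
(* Approximate minimality of [u n] against the competitor [u n + v]; it passes to
   the limit because only [Re <u n, v>] depends on [n]. *)
have main v : 0 <= 2 * complex.Re (inner l v - phi v) + rnorm v ^+ 2.
  rewrite leNgt; apply/negP; set D := _ + _ => D0.
  have e0 : 0 < - D / (2 * rnorm v + 2).
    by rewrite divr_gt0// ?oppr_gt0//; have := rnorm_ge0 v; lra.
  set e := - D / (2 * rnorm v + 2) in e0.
  have eD : e * (2 * rnorm v + 2) = - D.
    by rewrite /e divfK// gt_eqF//; have := rnorm_ge0 v; lra.
  have [N1 uN1] := small _ e0; have [N2 uN2] := ul _ e0.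
  pose n := maxn N1 N2.
  have := uN1 n (leq_maxl _ _); have := uN2 n (leq_maxr _ _).
  have := JI (u n + v); have := uI n; rewrite /J rnorm_sqrD phiD ReD.
  have := Re_inner_le (u n - l) v; rewrite innerDl innerNl ReD ReN.
  move: D0 eD; rewrite /D mulrDr (mulrCA e) ReD ReN => D0 De; move: De D0.
  move: (rnorm_ge0 v).
  move=> v0 De D0 uv uI' JIu ul1 un1.
  have := ler_wpM2r v0 (ltW ul1).
  move: (rnorm (u n - l) * rnorm v) (e * rnorm v) (n.+1%:R^-1) De uv uI' JIu un1 D0 => p q r.
  lra.
have main2 v : 0 <= complex.Re (inner l v - phi v).
  apply: (@quad_slope_ge0 _ (rnorm v ^+ 2)); first exact: sqr_ge0.
  move=> t t0; have := main (t%:C%C *: v).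
  rewrite phiZ innerZr rnormZr ?(ltW t0)// conj_Creal ?complex_real//.
  by rewrite -mulrBr ReZ exprMn; lra.
have main3 v : complex.Re (inner v l - phi v) = 0.
  have := main2 v; have := main2 ((-1) *: v).
  rewrite phiZ mulN1r scaleN1r innerNr opprK !ReD !ReN (Re_inner_sym l v); lra.
exists l => v; apply/eqP; rewrite eq_sym -subr_eq0; apply/eqP.
have := main3 ('i%C *: v); rewrite phiZ innerZl -mulrBr.
have := main3 v; case: (_ - _) => p q /= -> /eqP.
by rewrite mul0r mul1r sub0r oppr_eq0 => /eqP ->.
Qed.

(** Apply [Riesz] to [x |-> <f x, y>] for each [y]; the bound for [g] comes from
    [|g y|^2 = <f (g y), y>]. *)
Lemma adj_exists H K (f : bop H K) :
  exists g : bop K H, forall x y, inner (f x) y = inner x (g y).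
Proof.
have [B B0 fB] := bop_bounded f.
have /choice[g gE] : forall y, exists z, forall x, inner (f x) y = inner x z.
  move=> y; apply: (@Riesz _ _ (B * rnorm y)) => [x z|a x|x].
  - by rewrite linearD innerDl.
  - by rewrite linearZ innerZl.
  rewrite (le_trans (Re_inner_le _ _))// mulrAC ler_wpM2r ?rnorm_ge0//.
have gl : linear g.
  move=> a x y; apply: inner_ext => z.
  by rewrite innerC -gE innerDr innerZr rmorphD rmorphM/= conjCK !gE -!innerC
     innerDl innerZl.
have gB x : rnorm (g x) <= B * rnorm x.
  have [->|g0] := eqVneq (rnorm (g x)) 0; first by rewrite mulr_ge0 ?rnorm_ge0 ?ltW.
  have gp : 0 < rnorm (g x) by rewrite lt_def g0 rnorm_ge0.
  rewrite -(ler_pM2l gp) -expr2 rnorm_sqr -gE.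
  apply: le_trans (Re_inner_le _ _) _; have := fB (g x).
  by rewrite mulrA [_ * B]mulrC => h; rewrite ler_wpM2r ?rnorm_ge0.
by exists (Bop (bounded_linear_of_le gl gB)).
Qed.

Lemma adjE H K (f : bop H K) x y : inner (f x) y = inner x (adj f y).
Proof. by have := xgetPex 0 (adj_exists f); exact. Qed.

Lemma adjEr H K (f : bop H K) x y : inner x (f y) = inner (adj f x) y.
Proof. by rewrite innerC adjE -innerC. Qed.

Lemma adj_unique H K (f : bop H K) (g : bop K H) :
  (forall x y, inner (f x) y = inner x (g y)) -> adj f = g.
Proof.
by move=> h; apply: bop_inner_ext => y x; rewrite -adjEr innerC h -innerC.
Qed.

Lemma adjK H K (f : bop H K) : adj (adj f) = f.
Proof. by apply: adj_unique => x y; rewrite -adjEr. Qed.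

Lemma adj_comp H K L (f : bop H K) (g : bop K L) :
  adj (g \bo f) = adj f \bo adj g.
Proof. by apply: adj_unique => x y /=; rewrite !adjE. Qed.

Lemma adjM H (f g : bop H H) : adj (f * g) = adj g * adj f.
Proof. exact: adj_comp. Qed.

Lemma adj1 H : adj (1 : bop H H) = 1.
Proof. exact: adj_unique. Qed.

Lemma adjD H K (f g : bop H K) : adj (f + g) = adj f + adj g.
Proof. by apply: adj_unique => x y /=; rewrite innerDl innerDr !adjE. Qed.

Lemma adjN H K (f : bop H K) : adj (- f) = - adj f.
Proof. by apply: adj_unique => x y /=; rewrite innerNl innerNr !adjE. Qed.

Lemma adjZ H K (a : C) (f : bop H K) : adj (a *: f) = conjC a *: adj f.
Proof.
by apply: adj_unique => x y /=; rewrite innerZl innerZr !adjE conjCK.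
Qed.

End Riesz.

(** * Square roots of positive contractions *)

(** Vector identities reduce, by pairing with an arbitrary vector, to identities
    between scalars. *)
Ltac vring := apply: inner_ext => ?;
  rewrite ?(innerDl, innerNl, innerZl, inner0l); ring.

Section SquareRoot.
Variable R : realType.
Local Notation C := R[i].
Implicit Types H K L : hilbertType C.

Lemma bopDE H K (f g : bop H K) x : (f + g) x = f x + g x. Proof. by []. Qed.
Lemma bopNE H K (f : bop H K) x : (- f) x = - f x. Proof. by []. Qed.
Lemma bopZE H K (a : C) (f : bop H K) x : (a *: f) x = a *: f x. Proof. by []. Qed.
Lemma bop0E H K x : (0 : bop H K) x = 0. Proof. by []. Qed.
Lemma bopME H (f g : bop H H) x : (f * g) x = f (g x). Proof. by []. Qed.
Lemma bop1E H x : (1 : bop H H) x = x. Proof. by []. Qed.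
Lemma bcompE H K L (g : bop K L) (f : bop H K) x : (g \bo f) x = g (f x).
Proof. by []. Qed.
Definition bopE := (bopDE, bopNE, bopZE, bop0E, bopME, bop1E, bcompE).

Lemma bopLD H K (f : bop H K) x y : f (x + y) = f x + f y.
Proof. exact: linearD. Qed.
Lemma bopLN H K (f : bop H K) x : f (- x) = - f x.
Proof. exact: linearN. Qed.
Lemma bopLZ H K (f : bop H K) (a : C) x : f (a *: x) = a *: f x.
Proof. exact: linearZ. Qed.
Lemma bopL0 H K (f : bop H K) : f 0 = 0.
Proof. exact: linear0. Qed.

Lemma bopZAl H (a : C) (f g : bop H H) : (a *: f) * g = a *: (f * g).
Proof. by apply: bop_ext => x; rewrite !bopE. Qed.
Lemma bopZAr H (a : C) (f g : bop H H) : f * (a *: g) = a *: (f * g).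
Proof. by apply: bop_ext => x; rewrite !bopE linearZ. Qed.

Lemma commuteM H (T f g : bop H H) : T * f = f * T -> T * g = g * T ->
  T * (f * g) = f * g * T.
Proof. by move=> Tf Tg; rewrite mulrA Tf -mulrA Tg mulrA. Qed.
Lemma commuteD H (T f g : bop H H) : T * f = f * T -> T * g = g * T ->
  T * (f + g) = (f + g) * T.
Proof. by move=> Tf Tg; rewrite mulrDl mulrDr Tf Tg. Qed.
Lemma commuteN H (T f : bop H H) : T * f = f * T -> T * - f = - f * T.
Proof. by move=> Tf; rewrite mulrN mulNr Tf. Qed.
Lemma commuteZ H (a : C) (T f : bop H H) : T * f = f * T ->
  T * (a *: f) = a *: f * T.
Proof. by move=> Tf; rewrite bopZAr bopZAl Tf. Qed.
Lemma commute1 H (T : bop H H) : T * 1 = 1 * T.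
Proof. by rewrite mulr1 mul1r. Qed.

Lemma adj0 H K : adj (0 : bop H K) = 0.
Proof. by apply: adj_unique => x y; rewrite !bopE inner0l inner0r. Qed.

(** Polarization: the forms at [x + y] and [x + i y] are real. *)
Lemma positive_selfadj H (f : bop H H) : positive f -> adj f = f.
Proof.
move=> fp; apply: adj_unique => x y.
have im u : complex.Im (inner (f u) u) = 0 by apply: ger0_Im; exact: fp.
have h1 := im (x + y); have h2 := im (x + 'i%C *: y).
have hx := im x; have hy := im y.
have hiy := im ('i%C *: y).
rewrite [RHS]innerC.
move: h1 h2; rewrite !bopLD !innerDl !innerDr bopLZ !innerZl !innerZr.
move: hx hy hiy; rewrite bopLZ innerZl innerZr.
move: (inner (f x) y) (inner (f y) x) (inner (f x) x) (inner (f y) y).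
move=> [p q] [r s] [u v] [u' v'] /= -> ->.
rewrite !(mul0r,mul1r,mulr0,mulr1,add0r,addr0,subr0,sub0r,mulrN,mulNr,opprK).
move=> _ h1 h2; congr Complex; lra.
Qed.

Lemma selfadj_Re H (f : bop H H) x : adj f = f ->
  inner (f x) x = (complex.Re (inner (f x) x))%:C%C.
Proof.
move=> fa; have : inner (f x) x = conjC (inner (f x) x).
  by rewrite -innerC adjE fa.
case: (inner (f x) x) => p q [] /=; rewrite /real_complex_def => h; congr Complex; lra.
Qed.

Lemma adj_Re_unique H (f g : bop H H) :
  (forall x y, complex.Re (inner (f x) y - inner x (g y)) <= 0) -> adj f = g.
Proof.
move=> h; apply: adj_unique => x y.
have := h ('i%C *: x) y; have := h (- 'i%C *: x) y.
have := h (- 1 *: x) y; have := h x y.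
rewrite !bopLZ !innerZl.
move: (inner (f x) y) (inner x (g y)) => [p q] [r s] /=.
rewrite !(mul0r,mul1r,mulr0,mulr1,add0r,addr0,subr0,sub0r,mulrN,mulNr,opprK,oppr0).
move=> ? ? ? ?; congr Complex; lra.
Qed.

Section contraction.
Variables (H : hilbertType C) (z : bop H H).
Hypothesis za : adj z = z.
Hypothesis zle : forall h, rnorm (z h) <= rnorm h.

(** The square root of [1 - z] is [1 - Y], where [Y = (z + Y^2)/2]. *)
Fixpoint sqrt_seq n : bop H H :=
  if n is k.+1 then 2^-1 *: (z + sqrt_seq k * sqrt_seq k) else 0.
(** The same iteration with [z] replaced by the bound 1 of its norm. *)
Fixpoint sqrt_maj n : R := if n is k.+1 then (1 + sqrt_maj k ^+ 2) / 2 else 0.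
Local Notation y := sqrt_seq.
Local Notation r := sqrt_maj.

Lemma sqrt_seq0 : y 0 = 0. Proof. by []. Qed.
Lemma sqrt_seqS n : y n.+1 = 2^-1 *: (z + y n * y n). Proof. by []. Qed.
Lemma sqrt_maj0 : r 0 = 0. Proof. by []. Qed.
Lemma sqrt_majS n : r n.+1 = (1 + r n ^+ 2) / 2. Proof. by []. Qed.

Lemma rnorm_half (x : H) : rnorm (2^-1 *: x) = rnorm x / 2.
Proof.
have -> : (2^-1 : C) = (2^-1)%:C%C by rewrite fmorphV rmorph_nat.
by rewrite rnormZr ?invr_ge0// mulrC.
Qed.

Lemma sqrt_maj_bounds n : 0 <= r n <= r n.+1 /\ r n <= 1.
Proof.
elim: n => [|n /= [/andP[r0 rS] r1]]; first by rewrite /= expr0n /=; lra.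
by nra.
Qed.

Lemma sqrt_seq_le n h : rnorm (y n h) <= r n * rnorm h.
Proof.
elim: n h => [|n IH] h; first by rewrite sqrt_seq0 bopE rnorm0 mul0r.
rewrite sqrt_seqS sqrt_majS bopZE rnorm_half bopDE bopME.
have := rnormD (z h) (y n (y n h)); have := zle h; have := IH h; have := IH (y n h).
have [/andP[r0 _] _] := sqrt_maj_bounds n.
by move=> h1 /(ler_wpM2l r0); lra.
Qed.

Lemma sqrt_seq_comm T : T * z = z * T -> forall n, T * y n = y n * T.
Proof.
move=> Tz; elim=> [|n IH]; rewrite ?sqrt_seq0 ?sqrt_seqS; first by rewrite mulr0 mul0r.
exact/commuteZ/commuteD/commuteM.
Qed.

Lemma half_conj : conjC (2^-1 : C) = 2^-1.
Proof. by rewrite conj_Creal// rpredV rpred_nat. Qed.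

Lemma sqrt_seq_adj n : adj (y n) = y n.
Proof.
elim: n => [|n IH]; first by rewrite sqrt_seq0 adj0.
by rewrite sqrt_seqS adjZ half_conj adjD adjM IH za.
Qed.

Lemma sqrt_diff (f g : bop H H) h : f * g = g * f ->
  (2^-1 *: (z + g * g)) h - (2^-1 *: (z + f * f)) h =
  2^-1 *: (g (g h - f h) + f (g h - f h)).
Proof.
move=> fg; rewrite !bopZE -scalerBr; congr (_ *: _).
have e : f (g h) = g (f h) by rewrite -!bopME fg.
by rewrite !(bopLD, bopLN) e [RHS]addrA subrK !bopE opprD addrACA subrr add0r.
Qed.

(** The increments satisfy [2 (y'' - y') = (y' + y) (y' - y)], since all terms commute;
    the numbers [r n] obey the same identity, which propagates the majoration. *)
Lemma sqrt_seq_step n h : rnorm (y n.+1 h - y n h) <= (r n.+1 - r n) * rnorm h.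
Proof.
elim: n h => [|n IH] h.
  rewrite sqrt_seqS sqrt_majS sqrt_seq0 sqrt_maj0 !bopE addr0 subr0 rnorm_half expr0n /= addr0.
  by have := zle h; have := rnorm_ge0 h; lra.
have ycomm : y n * y n.+1 = y n.+1 * y n.
  by apply: sqrt_seq_comm; rewrite (sqrt_seq_comm (erefl _)).
rewrite (sqrt_diff _ ycomm : y n.+2 h - y n.+1 h = _).
rewrite rnorm_half.
have hd := IH h; move: hd; move: (y n.+1 h - y n h) => d hd.
have := rnormD (y n.+1 d) (y n d).
have := sqrt_seq_le n.+1 d; have := sqrt_seq_le n d; have := hd.
have [/andP[r0 r01] _] := sqrt_maj_bounds n.
rewrite (sqrt_majS n.+1); have e := sqrt_majS n.
move=> h1 h2 h3 h4.
have : (r n.+1 + r n) * rnorm d <= (r n.+1 + r n) * ((r n.+1 - r n) * rnorm h).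
  by rewrite ler_wpM2l//; lra.
have e2 : r n ^+ 2 = 2 * r n.+1 - 1 by lra.
move: h2 h3 h4 e2; clear; move: (r n.+1) (r n) (rnorm h) => s q w h2 h3 h4 e2.
have -> : (s + q) * ((s - q) * w) = (s ^+ 2 - q ^+ 2) * w by ring.
rewrite e2; lra.
Qed.

Lemma sqrt_seq_dist n k h : rnorm (y (n + k) h - y n h) <= (r (n + k) - r n) * rnorm h.
Proof.
elim: k => [|k IH]; first by rewrite addn0 !subrr rnorm0 mul0r.
rewrite addnS -(subrK (y (n + k) h) (y (n + k).+1 h)) -addrA.
have := rnormD (y (n + k).+1 h - y (n + k) h) (y (n + k) h - y n h).
by have := sqrt_seq_step (n + k) h; lra.
Qed.

(** The increasing bounded sequence [r] controls the distances between the
    operators [y n], so they converge at a rate [d n] uniform on bounded sets; every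
    algebraic property of [y n] passes to the limit because its defect at [h] is at
    most a constant times [d n]. *)
Lemma contraction_fixpoint : exists Y : bop H H,
  [/\ adj Y = Y, forall h, rnorm (Y h) <= rnorm h, Y + Y = z + Y * Y &
      forall T, T * z = z * T -> T * Y = Y * T].
Proof.
pose E : set R := range r.
have supE : has_sup E.
  split; first by exists (r 0%N); exists 0%N.
  by exists 1 => _ [n _ <-]; case: (sqrt_maj_bounds n).
pose rho := sup E; pose d n := rho - r n.
have r_le n : r n <= rho by apply: ub_le_sup; [case: supE|exists n].
have d0 n : 0 <= d n by rewrite subr_ge0.
have r_incr n k : r n <= r (n + k)%N.
  elim: k => [|k IH]; rewrite ?addn0// addnS (le_trans IH)//.
  by case: (sqrt_maj_bounds (n + k)) => /andP[].
have dsmall (e : R) : 0 < e -> exists N : nat, forall n, (N <= n)%N -> d n < e.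
  move=> e0; have [_ [N _ <-] h] := sup_adherent e0 supE.
  exists N => n /subnKC <-; have := r_incr N (n - N)%N.
  by rewrite /d -/rho in h *; lra.
have dzero (x M : R) : (forall n, x <= d n * M) -> x <= 0.
  move=> h; rewrite leNgt; apply/negP => x0.
  have e0 : 0 < x / (`|M| + 1) by rewrite divr_gt0// ltr_wpDl.
  have [N /(_ N (leqnn N))] := dsmall _ e0.
  rewrite ltr_pdivlMr ?ltr_wpDl// => dN.
  have := h N; have := ler_norm M; have := d0 N; nra.
have ydist n m h : (n <= m)%N -> rnorm (y m h - y n h) <= d n * rnorm h.
  move=> /subnKC <-; apply: le_trans (sqrt_seq_dist _ _ _) _.
  by rewrite ler_wpM2r ?rnorm_ge0// lerD2r r_le.
have /choice[Y YE] : forall h, exists l, forall n, rnorm (l - y n h) <= d n * rnorm h.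
  move=> h; have [|l yl] := @complete_seq _ _ (fun n => y n h).
    move=> e e0; have e1 : 0 < e / (2 * (rnorm h + 1)).
      by rewrite divr_gt0// mulr_gt0// ltr_wpDl ?rnorm_ge0.
    have [N dN] := dsmall _ e1; exists N => m n Nm Nn.
    have := ydist N m h Nm; have := ydist N n h Nn.
    have := rnormD (y m h - y N h) (- (y n h - y N h)).
    rewrite rnormN opprB addrA subrK.
    have := dN N (leqnn _); rewrite ltr_pdivlMr ?mulr_gt0 ?ltr_wpDl ?rnorm_ge0//.
    have := d0 N; have := rnorm_ge0 h; nra.
  exists l => n; rewrite -subr_le0 leNgt; apply/negP => e0.
  have [N /(_ (maxn N n) (leq_maxl _ _)) h1] := yl _ e0.
  have := ydist n (maxn N n) h (leq_maxr _ _).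
  have := rnormD (- (y (maxn N n) h - l)) (y (maxn N n) h - y n h).
  by rewrite rnormN opprB addrA subrK; move: h1; lra.
have YEn n h : rnorm (y n h - Y h) <= d n * rnorm h.
  by rewrite -rnormN opprB; exact: YE.
have rnorm_dzero (u : H) M : (forall n, rnorm u <= d n * M) -> u = 0.
  by move=> /dzero u0; apply: rnorm_eq0; apply/eqP; rewrite eq_le u0 rnorm_ge0.
have Yl : linear Y.
  move=> a u v; apply/eqP; rewrite -subr_eq0; apply/eqP.
  apply: (@rnorm_dzero _ (rnorm (a *: u + v) + complex.Re `|a| * rnorm u + rnorm v)) => n.
  have -> : Y (a *: u + v) - (a *: Y u + Y v) =
      (Y (a *: u + v) - y n (a *: u + v)) + (a *: (y n u - Y u) + (y n v - Y v)).
    by rewrite bopLD bopLZ; vring.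
  apply: le_trans (rnormD _ _) _; rewrite -addrA mulrDr lerD//.
  apply: le_trans (rnormD _ _) _; rewrite mulrDr lerD// rnormZ mulrCA ler_wpM2l//.
  by rewrite -ler0c RRe_real ?normr_real.
have YB h : rnorm (Y h) <= 1 * rnorm h.
  rewrite mul1r -subr_le0; apply: (dzero _ (rnorm h)) => n.
  have := rnormD (Y h - y n h) (y n h); rewrite subrK.
  have := YE h n; have := sqrt_seq_le n h.
  by have [_] := sqrt_maj_bounds n; have := rnorm_ge0 h; nra.
pose Yb := Bop (bounded_linear_of_le Yl YB).
have YbE h : Yb h = Y h by [].
exists Yb; split.
- apply: adj_Re_unique => u v; rewrite !YbE.
  apply: (dzero _ (2 * (rnorm u * rnorm v))) => n.
  have yn : inner (y n u) v = inner u (y n v).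
    by rewrite [RHS]adjEr sqrt_seq_adj.
  have -> : inner (Y u) v - inner u (Y v) =
      inner (Y u - y n u) v + inner u (y n v - Y v).
    by rewrite innerDl innerDr innerNl innerNr yn; ring.
  rewrite ReD.
  have := Re_inner_le (Y u - y n u) v; have := Re_inner_le u (y n v - Y v).
  have := ler_wpM2r (rnorm_ge0 v) (YE u n); have := ler_wpM2l (rnorm_ge0 u) (YEn n v).
  lra.
- by move=> h; rewrite YbE -[leRHS]mul1r.
- apply: bop_ext => h; apply/eqP; rewrite -subr_eq0; apply/eqP.
  apply: (@rnorm_dzero _ (4 * rnorm h)) => n.
  have zE : z h = 2 *: y n.+1 h - y n (y n h).
    by rewrite sqrt_seqS !bopE scalerA divff ?pnatr_eq0// scale1r addrK.
  rewrite !bopE !YbE zE.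
  have -> : Y h + Y h - (2 *: y n.+1 h - y n (y n h) + Y (Y h)) =
      (Y h - y n.+1 h) + (Y h - y n.+1 h) +
      (y n (y n h - Y h) + (y n (Y h) - Y (Y h))).
    by rewrite bopLD bopLN; vring.
  have := rnormD ((Y h - y n.+1 h) + (Y h - y n.+1 h))
              (y n (y n h - Y h) + (y n (Y h) - Y (Y h))).
  have := rnormD (Y h - y n.+1 h) (Y h - y n.+1 h).
  have := rnormD (y n (y n h - Y h)) (y n (Y h) - Y (Y h)).
  have y1 u : rnorm (y n u) <= rnorm u.
    have := sqrt_seq_le n u; have [_] := sqrt_maj_bounds n.
    by have := rnorm_ge0 u; nra.
  have := y1 (y n h - Y h); have := YEn n h; have := YEn n (Y h).
  have := YE h n.+1; have := ler_wpM2l (d0 n) (YB h).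
  have : d n.+1 * rnorm h <= d n * rnorm h.
    by rewrite ler_wpM2r ?rnorm_ge0// lerD2l lerN2 -addn1 r_incr.
  lra.
- move=> T Tz; have [B B0 TB] := bop_bounded T.
  apply: bop_ext => h; apply/eqP; rewrite -subr_eq0; apply/eqP.
  apply: (@rnorm_dzero _ (2 * B * rnorm h)) => n; rewrite !bopE !YbE.
  have Ty : T (y n h) = y n (T h) by rewrite -!bopME sqrt_seq_comm.
  have -> : T (Y h) - Y (T h) = T (Y h - y n h) + (y n (T h) - Y (T h)).
    by rewrite bopLD bopLN Ty; vring.
  apply: le_trans (rnormD _ _) _.
  have := TB (Y h - y n h); have := YEn n (T h).
  have := ler_wpM2l (d0 n) (TB h); have := ler_wpM2l (ltW B0) (YE h n).
  lra.
Qed.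

End contraction.
End SquareRoot.

(** * Absolute values, kernel projections and signs *)

(** The operator version of [vring]: it uses linearity and associativity, so
    relations between operators have to be rewritten beforehand. *)
Ltac opring := apply: bop_inner_ext => ? ?;
  rewrite !bopE ?(bopLD, bopLN, bopLZ, bopL0)
    ?(innerDl, innerNl, innerZl, inner0l); ring.

Section Operators.
Variable R : realType.
Local Notation C := R[i].
Implicit Types H K L : hilbertType C.

Lemma bop_inj_cancel H (c f g : bop H H) :
  (forall h, c h = 0 -> h = 0) -> c * f = c * g -> f = g.
Proof.
move=> c0 fg; apply: bop_ext => h; apply/eqP; rewrite -subr_eq0; apply/eqP/c0.
by rewrite bopLD bopLN -!bopME fg subrr.
Qed.

Lemma rnorm_selfadj_sqr H (m : bop H H) h : adj m = m ->
  complex.Re (inner (m (m h)) h) = rnorm (m h) ^+ 2.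
Proof. by move=> ma; rewrite adjE ma rnorm_sqr. Qed.

(** After scaling [m] to a contraction [k], the operator [z = 1 - k^2] is a contraction
    because [|z h|^2 = |h|^2 - 2 |k h|^2 + |k^2 h|^2]; then [g] is a multiple of [1 - Y]
    for the fixpoint [Y] of [contraction_fixpoint]. *)
Lemma sqrt_of_square H (m : bop H H) : adj m = m -> exists g : bop H H,
  [/\ positive g, g * g = m * m &
      forall T, T * (m * m) = m * m * T -> T * g = g * T].
Proof.
move=> ma; have [B B0 mB] := bop_bounded m.
pose k : bop H H := (B^-1)%:C%C *: m.
have ka : adj k = k by rewrite adjZ ma conj_Creal// complex_real.
have kle h : rnorm (k h) <= rnorm h.
  by rewrite rnormZr ?invr_ge0 ?(ltW B0)// ler_pdivrMl//; exact: mB.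
pose z := 1 - k * k.
have za : adj z = z by rewrite adjD adj1 adjN adjM ka.
have zle h : rnorm (z h) <= rnorm h.
  rewrite -(@ler_pXn2r _ 2) ?nnegrE ?rnorm_ge0// !bopE rnorm_sqrD rnormN innerNr ReN.
  rewrite Re_inner_sym (rnorm_selfadj_sqr _ ka).
  have := kle (k h); have := rnorm_ge0 (k (k h)); have := rnorm_ge0 (k h); nra.
have [Y [Ya Yle YE Yc]] := contraction_fixpoint za zle.
exists (B%:C%C *: (1 - Y)); split.
- move=> h; rewrite !bopE innerZl mulr_ge0 ?ler0c ?(ltW B0)//.
  rewrite innerDl innerNl (selfadj_Re _ Ya) inner_rnorm subr_ge0 lecR.
  apply: le_trans (Re_inner_le _ _) _; rewrite expr2 ler_wpM2r ?rnorm_ge0//.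
- have -> : (B%:C%C *: (1 - Y)) * (B%:C%C *: (1 - Y)) =
    (B%:C%C * B%:C%C) *: (1 - (Y + Y - Y * Y)) by opring.
  rewrite YE addrK /z opprB addrCA subrr addr0.
  rewrite /k bopZAl bopZAr !scalerA -!rmorphM/=.
  have -> : B * B * B^-1 * B^-1 = 1 by field; rewrite gt_eqF.
  by rewrite scale1r.
move=> T Tm; apply: commuteZ; apply: commuteD; first exact: commute1.
apply: commuteN; apply: Yc; apply: commuteD; first exact: commute1.
apply: commuteN; rewrite /k bopZAl [m * _]bopZAr scalerA.
exact: commuteZ.
Qed.

(** The positive form [<g u, u>] at [u = k - t g k] has slope [- 2 |g k|^2] in [t]. *)
Lemma positive_ker H (g : bop H H) k : positive g -> inner (g k) k = 0 -> g k = 0.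
Proof.
move=> gp gk; have ga := positive_selfadj gp.
have Re0 u : 0 <= complex.Re (inner (g u) u).
  by rewrite -ler0c -selfadj_Re//; exact: gp.
suff : 0 <= - rnorm (g k) ^+ 2.
  move=> h; apply: rnorm_eq0; apply/eqP; rewrite -sqrf_eq0 eq_le sqr_ge0 andbT.
  by rewrite -oppr_ge0.
apply: (@quad_slope_ge0 _ _ (complex.Re (inner (g (g k)) (g k)))) => // t t0.
have := Re0 (k - t%:C%C *: g k).
rewrite bopLD bopLN bopLZ !(innerDl, innerDr, innerNl, innerNr, innerZl, innerZr) gk.
rewrite conj_Creal ?complex_real// (adjE g (g k) k) ga add0r.
rewrite !(ReD, ReN, ReZ) -rnorm_sqr; lra.
Qed.

(** With [k = g h - f h] one gets [(g + f) k = 0], so both positive forms vanish at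
    [k] and [g k = f k = 0]; then [|k|^2 = <(g - f) k, h> = 0]. *)
Lemma sqrt_unique H (g f : bop H H) : positive g -> positive f ->
  g * g = f * f -> g * f = f * g -> g = f.
Proof.
move=> gp fp sq gf; apply: bop_ext => h; apply/eqP; rewrite -subr_eq0; apply/eqP.
set k := g h - f h.
have gfk : g k + f k = 0.
  rewrite /k !(bopLD, bopLN) -!bopME sq gf; rewrite !bopE; vring.
have ikk : inner (g k) k + inner (f k) k = 0 by rewrite -innerDl gfk inner0l.
have /eqP := ikk; rewrite paddr_eq0; [|exact: gp|exact: fp].
move=> /andP[/eqP gk0 /eqP fk0].
have gk : g k = 0 by exact: positive_ker.
have fk : f k = 0 by exact: positive_ker.
apply: inner_eq0; rewrite -/k {1}/k innerDl innerNl !adjE !positive_selfadj//.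
by rewrite gk fk inner0r subrr.
Qed.

(** The chosen root commutes with its own square, hence with the root [g] of
    [sqrt_of_square], so uniqueness applies and the commutation property of [g]
    transfers. *)
Lemma oabsP H (m : bop H H) : adj m = m ->
  [/\ positive (oabs m), oabs m * oabs m = m * m &
      forall T, T * (m * m) = m * m * T -> T * oabs m = oabs m * T].
Proof.
move=> ma; have [g [gp gg gc]] := sqrt_of_square ma.
have [op oE] : positive (oabs m) /\ oabs m * oabs m = adj m * m.
  by apply: (xgetPex 0 (P := [set f | positive f /\ f * f = adj m * m]));
    exists g; split; rewrite // ma.
rewrite ma in oE; split => // T Tm.
have <- : g = oabs m; last exact: gc.
apply: sqrt_unique => //; first by rewrite gg oE.
by rewrite -gc// -oE mulrA.
Qed.

Lemma pval_bounded_linear H (p : bop H H) :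
  (@pval C H p) \in bounded_linear (pspace p) H.
Proof. by apply: bounded_linear_contract => // x; rewrite pval_norm. Qed.

Definition pinc H (p : bop H H) : bop (pspace p) H := Bop (pval_bounded_linear p).

Lemma pincP H (p : bop H H) k : p (pinc p k) = pinc p k.
Proof. by apply/eqP; exact: pvalP. Qed.

Lemma pinc_surj H (p : bop H H) h : p h = h -> exists k, h = pinc p k.
Proof. by move=> /eqP ph; exists (PSpace ph). Qed.

Lemma pinc_inner H (p : bop H H) k l : inner (pinc p k) (pinc p l) = inner k l.
Proof. by []. Qed.

Lemma pincK H (p : bop H H) k : adj (pinc p) (pinc p k) = k.
Proof. by apply: inner_ext => l; rewrite -adjEr pinc_inner. Qed.

(** The kernel of [T] is the fixed space of [1 - T], a Hilbert space; the
    projection is [i i*] for its inclusion [i]. *)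
Lemma kernel_projection H (T : bop H H) : exists2 e : bop H H,
  projection e & forall h, T h = 0 <-> e h = h.
Proof.
pose i := pinc (1 - T); have iK k : adj i (i k) = k := pincK k.
exists (i \bo adj i); first split.
- by apply: bop_ext => h; rewrite !bopE iK.
- by rewrite adj_comp adjK.
move=> h; split=> [Th|eh].
  have [k ->] : exists k, h = i k by apply: pinc_surj; rewrite !bopE Th subr0.
  by rewrite bopE iK.
have : (1 - T) h = h by rewrite -eh bcompE; exact: pincP.
rewrite !bopE => /eqP; rewrite -subr_eq0 addrAC subrr sub0r oppr_eq0.
by move/eqP.
Qed.

(** Since [(x - c) (x + c) = 0], the projection [e] onto the kernel of [x - c]
    fixes the range of [x + c], and [x = c (2 e - 1)].  Injectivity of [c] makes
    the sign unique, so it commutes with whatever commutes with [x] and [c]. *)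
Lemma signP H (x c : bop H H) : adj x = x -> adj c = c -> x * c = c * x ->
  x * x = c * c -> (forall h, c h = 0 -> h = 0) -> exists s : bop H H,
  [/\ adj s = s, s * s = 1, x = c * s &
      forall T, T * x = x * T -> T * c = c * T -> T * s = s * T].
Proof.
move=> xa ca xc xxcc c0.
have [e [ee ea] eE] := kernel_projection (x - c).
have exc : e * (x + c) = x + c.
  have z0 : (x - c) * (x + c) = 0.
    by rewrite mulrDl mulNr !mulrDr xxcc xc [c * c + _]addrC subrr.
  by apply: bop_ext => h; rewrite bopME; apply/eE; rewrite -bopME z0.
have xce : (x + c) * e = x + c.
  by have := congr1 (@adj _ _ _) exc; rewrite adjM adjD xa ca ea.
have xe : x * e = c * e.
  apply: bop_ext => h; apply/eqP; rewrite -subr_eq0 !bopE; apply/eqP.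
  by have := (eE (e h)).2; rewrite !bopE; apply; rewrite -bopME ee.
have xE : x = c * (e + e - 1).
  rewrite mulrDr mulrDr mulrN mulr1; move: xce; rewrite mulrDl xe => ->.
  by rewrite addrK.
exists (e + e - 1); split => //.
- by rewrite !adjD adjN adj1 ea.
- by rewrite mulrDl mulNr !mulrDr !mulrDl !mulrN !mulr1 mul1r ee; opring.
move=> T Tx Tc; apply: (bop_inj_cancel c0).
by rewrite [RHS]mulrA -xE -Tx [in RHS]xE !mulrA Tc.
Qed.

End Operators.

(** * Commutants and strict effects *)

Section VonNeumann.
Variable R : realType.
Local Notation C := R[i].
Implicit Types H K L : hilbertType C.

Definition star_closed H (S : set (bop H H)) := forall x, S x -> S (adj x).

Lemma commutant_anti H (S T : set (bop H H)) : S `<=` T ->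
  commutant T `<=` commutant S.
Proof. by move=> ST y yT x /ST; exact: yT. Qed.

Lemma sub_bicommutant H (S : set (bop H H)) : S `<=` commutant (commutant S).
Proof. by move=> x Sx y /(_ x Sx). Qed.

Lemma commutant3 H (S : set (bop H H)) :
  commutant (commutant (commutant S)) = commutant S.
Proof.
rewrite eqEsubset; split; last exact: sub_bicommutant.
exact/commutant_anti/sub_bicommutant.
Qed.

Lemma commutant_star H (S : set (bop H H)) : star_closed S ->
  star_closed (commutant S).
Proof.
move=> Ss y yS x Sx.
by have := congr1 (@adj _ _ _) (yS _ (Ss _ Sx)); rewrite !adjM adjK.
Qed.

Lemma commutant_von_neumann H (S : set (bop H H)) : star_closed S ->
  von_neumann (commutant S).
Proof.
move=> Ss; split; last exact: commutant3.
split=> [x _|c x y xS yS z Sz|x y xS yS z Sz|].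
- exact: commute1.
- by apply: commuteD; [apply: commuteZ; exact: xS|exact: yS].
- by apply: commuteM; [exact: xS|exact: yS].
- exact: commutant_star.
Qed.

Lemma bicommutant_von_neumann H (S : set (bop H H)) : star_closed S ->
  von_neumann (commutant (commutant S)).
Proof. by move=> Ss; exact/commutant_von_neumann/commutant_star. Qed.

Lemma bicommutant_abelian H (S : set (bop H H)) :
  (forall x y, S x -> S y -> x * y = y * x) -> abelian (commutant (commutant S)).
Proof.
move=> Sc x y xS yS; apply: yS; apply: commutant_anti xS => z Sz w Sw.
exact: Sc.
Qed.

(** The double commutant of [S] is a von Neumann algebra between [S] and [M], and it
    lies in any von Neumann algebra containing [S]. *)
Lemma vN_generatedE H (M S : set (bop H H)) : von_neumann M ->
  S `<=` M -> star_closed S -> vN_generated M S = commutant (commutant S).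
Proof.
move=> [_ MM] SM Ss; rewrite eqEsubset; split => [x|x Sx N [_ NN] _ SN].
  apply; [exact: bicommutant_von_neumann| |exact: sub_bicommutant].
  by rewrite -MM; exact/commutant_anti/commutant_anti.
by rewrite -NN; apply: commutant_anti Sx; exact: commutant_anti.
Qed.

Lemma von_neumann_mem H (M : set (bop H H)) x : von_neumann M ->
  (forall y, commutant M y -> y * x = x * y) -> M x.
Proof. by move=> [_ {2}<-] h y My; exact: h. Qed.

(** Operators in the commutant, and their adjoints, preserve the kernel of [T]; so
    they commute with the projection onto it. *)
Lemma kernel_projection_mem H (M : set (bop H H)) (T e : bop H H) :
  von_neumann M -> M T -> projection e ->
  (forall h, T h = 0 <-> e h = h) -> M e.
Proof.
move=> Mv MT [ee ea] eE; apply: von_neumann_mem => //.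
have eye z : commutant M z -> e * z * e = z * e.
  move=> zM; apply: bop_ext => h; rewrite !bopME; apply/eE.
  rewrite -bopME zM// bopME; have -> : T (e h) = 0 by apply/eE; rewrite -bopME ee.
  by rewrite bopL0.
move=> y yM; rewrite -(eye y)//.
have ysM : commutant M (adj y).
  by apply: commutant_star yM; case: Mv => -[].
have := congr1 (@adj _ _ _) (eye _ ysM).
by rewrite !adjM adjK ea mulrA.
Qed.

Lemma projection_positive H (p : bop H H) : projection p -> positive p.
Proof. by move=> [pp pa] h; rewrite -{1}pp bopME adjE pa inner_ge0. Qed.

Lemma projection_le0 H (p : bop H H) : projection p -> ople p 0 -> p = 0.
Proof.
move=> pP p0; apply: bop_ext => h; rewrite bop0E.
apply: positive_ker; first exact: projection_positive.
apply/eqP; rewrite eq_le projection_positive// andbT.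
by have := p0 h; rewrite !bopE sub0r innerNl oppr_ge0.
Qed.

Lemma effect_selfadj H (M : set (bop H H)) a : effect M a -> adj a = a.
Proof.
move=> [_ a0 _]; apply: positive_selfadj.
by move=> h; have := a0 h; rewrite !bopE subr0.
Qed.

(** On the range of [r] the form of [a] is squeezed between those of [r] and 1, so
    [1 - a] vanishes there. *)
Lemma projections_below_strict H (a r : bop H H) :
  ople a 1 -> (forall h, a h = h -> h = 0) ->
  projection r -> ople r a -> r = 0.
Proof.
move=> a1 ker1 [rr ra] rle; apply: bop_ext => h; rewrite bop0E.
have rh : r (r h) = r h by rewrite -bopME rr.
apply: ker1; apply/eqP; rewrite eq_sym -subr_eq0; apply/eqP.
rewrite -[LHS]/((1 - a) (r h)); apply: positive_ker => //.
apply/eqP; rewrite eq_le (a1 (r h)) andbT.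
have := rle (r h); rewrite !bopE rh !innerDl !innerNl.
by rewrite subr_ge0 subr_le0.
Qed.

(** The kernel projections of [a] and [1 - a] belong to [M].  The first annihilates
    [a]; the second lies below [a], because [a - e = (1 - e) a (1 - e)]. *)
Lemma strictP H (M : set (bop H H)) (a : bop H H) :
  von_neumann M -> effect M a ->
  strict M a <->
  (forall h, a h = 0 -> h = 0) /\ (forall h, a h = h -> h = 0).
Proof.
move=> Mv aE; have aa := effect_selfadj aE; have [Ma a0 a1] := aE.
have [[M1 Mlin MM Ms] _] := Mv.
have M0 : M 0.
  by rewrite -(addNr (1 : bop H H)) -scaleN1r; exact: Mlin.
have P00 : projection (0 : bop H H) by split; rewrite ?mul0r ?adj0.
have leP q : projections M q -> ople 0 q.
  by move=> [_ /projection_positive qp] h; rewrite !bopE subr0; exact: qp.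
split=> [[[_ s1 _] [_ n1 _]]|[ker0 ker1]]; last first.
  have le00 : ople (0 : bop H H) 0.
    by move=> h; rewrite !bopE subr0 inner0l.
  split; split.
  - by split.
  - by move=> r [[_ rp] ra]; rewrite (projections_below_strict a1 ker1 rp ra).
  - by move=> q /leP.
  - by split.
  - move=> r [[_ [rr rs]] ra]; have -> : r = 0; last exact: le00.
    apply: (bop_inj_cancel ker0); rewrite mulr0.
    by have := congr1 (@adj _ _ _) ra; rewrite adjM aa rs adj0.
  - by move=> q /leP.
split=> h.
  have [e eP eE] := kernel_projection a.
  have Me := kernel_projection_mem Mv Ma eP eE.
  have ae : a * e = 0.
    by apply: bop_ext => k; rewrite bopME bop0E; apply/eE; rewrite -bopME eP.1.
  have e0 : e = 0.
    apply: projection_le0 => //; apply: n1; split=> //.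
    by have := congr1 (@adj _ _ _) ae; rewrite adjM aa eP.2 adj0.
  by move=> /eE <-; rewrite e0.
have [e eP eE] := kernel_projection (1 - a).
have M1a : M (1 - a) by rewrite addrC -scaleN1r; exact: Mlin.
have Me := kernel_projection_mem Mv M1a eP eE.
have ae : a * e = e.
  apply: bop_ext => k; apply/eqP; rewrite eq_sym -subr_eq0; apply/eqP.
  by apply: (eE (e k)).2; rewrite -bopME eP.1.
have ea : e * a = e.
  by have := congr1 (@adj _ _ _) ae; rewrite adjM aa eP.2.
have e0 : e = 0.
  apply: projection_le0 => //; apply: s1; split=> // k.
  have -> : a - e = (1 - e) * a * (1 - e).
    rewrite mulrDl mul1r mulNr ea mulrDr mulr1 mulrN.
    by rewrite (mulrDl a) ae mulNr eP.1 subrr oppr0 addr0.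
  have := a0 ((1 - e) k); rewrite !bopME !bopDE !bopNE !bop1E !bop0E subr0.
  by rewrite (adjE (1 - e)) adjD adjN adj1 eP.2 !bopE.
move=> ah; have <- : e h = h; last by rewrite e0.
by apply/eE; rewrite !bopE ah subrr.
Qed.

End VonNeumann.

(** * Two symmetries without joint eigenvectors *)

Section Symmetries.
Variable R : realType.
Local Notation C := R[i].
Implicit Types H K L : hilbertType C.

Lemma selfadj_sqr_ker H (m : bop H H) h : adj m = m -> m (m h) = 0 -> m h = 0.
Proof.
by move=> ma mm; apply: rnorm_eq0; apply/eqP; rewrite -sqrf_eq0 -rnorm_selfadj_sqr// mm inner0l.
Qed.

Lemma imagC : conjC ('i%C : C) = - 'i%C.
Proof. by congr Complex; rewrite oppr0. Qed.

Lemma imag_sqr : ('i%C * 'i%C : C) = -1.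
Proof. by rewrite -expr2 sqr_i. Qed.

Section two_symmetries.
Variables (H : hilbertType C) (s t : bop H H).
Hypotheses (sa : adj s = s) (ss : s * s = 1) (ta : adj t = t) (tt : t * t = 1).
Hypothesis no_joint_eigenvector : forall (e f : C) h,
  e * e = 1 -> f * f = 1 -> s h = e *: h -> t h = f *: h -> h = 0.

Let sK h : s (s h) = h. Proof. by rewrite -bopME ss. Qed.
Let tK h : t (t h) = h. Proof. by rewrite -bopME tt. Qed.

Let m : bop H H := 'i%C *: (s * t - t * s).
Let E : bop H H := s * t + t * s.

Let ma : adj m = m.
Proof.
by rewrite /m adjZ adjD adjN !adjM sa ta imagC scaleNr -scalerN opprB.
Qed.

Let mm : m * m = 4 *: (1 : bop H H) - E * E.
Proof.
rewrite /m /E bopZAl bopZAr scalerA imag_sqr.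
apply: bop_inner_ext => h k; rewrite !bopE !(bopLD, bopLN).
by rewrite !(sK, tK) !(innerZl, innerDl, innerNl); ring.
Qed.

Let m_anticomm_t : m * t = - (t * m).
Proof.
rewrite /m bopZAl bopZAr -scalerN; congr (_ *: _).
by rewrite mulrDl mulrDr mulNr mulrN -!mulrA tt !mulrA tt mulr1 mul1r opprB.
Qed.

(** On the kernel of [m] the symmetries commute, so the four vectors
    [h + e s h + f t h + e f s t h] with signs [e], [f] are joint eigenvectors; they
    vanish, and their sum is [4 h]. *)
Let m_inj h : m h = 0 -> h = 0.
Proof.
move=> mh; have st : s (t h) = t (s h).
  apply/eqP; rewrite -subr_eq0; apply/eqP.
  have := congr1 (fun v => (- 'i%C) *: v) mh.
  by rewrite /m !bopE scalerA mulNr imag_sqr opprK scale1r scaler0.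
have v0 (e f : C) : e * e = 1 -> f * f = 1 ->
    h + e *: s h + f *: t h + (e * f) *: s (t h) = 0.
  move=> ee ff; apply: (no_joint_eigenvector ee ff).
  - rewrite !(bopLD, bopLZ) !sK !scalerDr !scalerA mulrA ee !mul1r scale1r.
    by vring.
  - rewrite !(bopLD, bopLZ) st !tK !scalerDr !scalerA ff -st.
    by rewrite mulrCA ff mulr1 scale1r (mulrC f e); vring.
have N1 : -1 * -1 = 1 :> C by rewrite mulrNN mulr1.
have := v0 1 1 (mulr1 _) (mulr1 _); have := v0 1 (-1) (mulr1 _) N1.
have := v0 (-1) 1 N1 (mulr1 _); have := v0 (-1) (-1) N1 N1.
move=> h1 h2 h3 h4.
have : (4 : C) *: h = 0.
  rewrite -[RHS](addr0 0) -{1}h1 -h2 -[RHS]addr0 -{1}h3 -[RHS]addr0 -{1}h4.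
  by vring.
by move/eqP; rewrite scaler_eq0 pnatr_eq0/= => /eqP.
Qed.

(** Here [g = |m|] and [q] is the sign of [m].  Since [m^2 = 4 - E^2], anything
    commuting with [E] commutes with [g]; and [q] inherits from [m] the
    anticommutation with [t].  The formula for [2 s] is [(st + ts) t + (st - ts) t]
    with [st - ts = - i m]. *)
Lemma two_symmetries : exists g q : bop H H,
  [/\ [/\ adj g = g, g * g = 4 *: (1 : bop H H) - E * E & forall h, g h = 0 -> h = 0],
      [/\ adj q = q, q * q = 1 & q * t = - (t * q)],
      s + s = E * t - 'i%C *: (g * q * t),
      forall T, T * E = E * T -> T * g = g * T &
      forall T, T * s = s * T -> T * t = t * T -> T * q = q * T].
Proof.
have [gp gg gc] := oabsP ma; have ga := positive_selfadj gp.
set g := oabs m in gp gg gc ga.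
have g0 h : g h = 0 -> h = 0.
  move=> gh; apply: m_inj; apply: selfadj_sqr_ker => //.
  by rewrite -bopME -gg bopME gh bopL0.
have mg : m * g = g * m by apply: gc; rewrite mulrA.
have [q [qa qq mE qc]] := signP ma ga mg (esym gg) g0.
have gE T : T * E = E * T -> T * g = g * T.
  move=> TE; apply: gc; rewrite mm; apply: commuteD.
    exact/commuteZ/commute1.
  exact/commuteN/commuteM.
have tE : t * E = E * t.
  by rewrite /E mulrDr mulrDl -!mulrA tt !mulrA tt mulr1 mul1r addrC.
exists g, q; split=> //.
- by rewrite gg mm.
- split=> //; apply: (bop_inj_cancel g0).
  by rewrite mulrN !mulrA -mE -(gE t tE) -mulrA -mE m_anticomm_t.
- rewrite -mE /m bopZAl scalerA imag_sqr scaleN1r opprK /E !mulrDl mulNr.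
  by rewrite -(mulrA s) tt mulr1 addrACA subrr addr0.
move=> T Ts Tt; have Tst := commuteM Ts Tt; have Tts := commuteM Tt Ts.
apply: qc; first by apply/commuteZ/commuteD => //; exact: commuteN.
by apply: gE; exact: commuteD.
Qed.

End two_symmetries.

(** If [c h = 0] then [a h = b h], and the same holds for [k = a h] because [c]
    commutes with [a].  Expanding [y^2 h = (1 - c)^2 h = h] gives [a k = k], which
    strictness of [a] excludes unless [k = 0], and then [h = 0].  With [b] replaced
    by [1 - b] the operators [c] and [1 - c] exchange roles. *)
Lemma abs_compat_ker H (a b c : bop H H) : adj (a - b) = a - b ->
  (forall h, a h = 0 -> h = 0) -> (forall h, a h = h -> h = 0) ->
  c * a = a * c ->
  c * c = (a - b) * (a - b) -> (1 - c) * (1 - c) = (1 - a - b) * (1 - a - b) ->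
  forall h, c h = 0 -> h = 0.
Proof.
move=> xa a0 a1 ca cx cy.
have ab u : c u = 0 -> b u = a u.
  move=> cu; apply/eqP; rewrite eq_sym -subr_eq0; apply/eqP.
  rewrite -[LHS]/((a - b) u); apply: selfadj_sqr_ker => //.
  by rewrite -bopME -cx bopME cu bopL0.
move=> h ch; apply: (a0); apply: (a1).
have ck : c (a h) = 0 by rewrite -bopME ca bopME ch bopL0.
have := congr1 (fun f : bop H H => f h) cy.
rewrite !bopE ?(bopLD, bopLN) !(ab h ch) !(ab _ ck) ch.
rewrite ?(bopL0, oppr0, addr0).
move=> hE; apply/eqP; rewrite -subr_eq0; apply/eqP.
have : (4 : C) *: (a (a h) - a h) = 0.
  by rewrite -(subrr h) [X in _ = X - _]hE; vring.
by move/eqP; rewrite scaler_eq0 pnatr_eq0/= => /eqP.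
Qed.

End Symmetries.

(** * Unitary conjugation and two-by-two matrices *)

Section UnitaryConjugation.
Variable R : realType.
Local Notation C := R[i].
Variables (L H : hilbertType C) (U : bop L H).
Hypothesis UP : unitary U.

(** [pull T] is the matrix of [T] and [push Z] the operator with matrix [Z] when [L]
    is a space of columns. *)
Definition pull (T : bop H H) : bop L L := adj U \bo T \bo U.
Definition push (Z : bop L L) : bop H H := U \bo Z \bo adj U.

Lemma unitaryK x : adj U (U x) = x.
Proof. by rewrite -bcompE UP.1. Qed.
Lemma unitaryKV h : U (adj U h) = h.
Proof. by rewrite -bcompE UP.2. Qed.

Lemma pullE T x : pull T x = adj U (T (U x)). Proof. by []. Qed.
Lemma pushE Z h : push Z h = U (Z (adj U h)). Proof. by []. Qed.

Lemma pushK Z : pull (push Z) = Z.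
Proof. by apply: bop_ext => x; rewrite pullE pushE !unitaryK. Qed.
Lemma pullK T : push (pull T) = T.
Proof. by apply: bop_ext => x; rewrite pushE pullE !unitaryKV. Qed.
Lemma pull_inj S T : pull S = pull T -> S = T.
Proof. by move=> ST; rewrite -(pullK S) ST pullK. Qed.

Lemma pullM S T : pull (S * T) = pull S * pull T.
Proof. by apply: bop_ext => x; rewrite bopME !pullE unitaryKV. Qed.
Lemma pullD S T : pull (S + T) = pull S + pull T.
Proof. by apply: bop_ext => x; rewrite bopDE !pullE bopDE bopLD. Qed.
Lemma pullN T : pull (- T) = - pull T.
Proof. by apply: bop_ext => x; rewrite bopNE !pullE bopNE bopLN. Qed.
Lemma pullZ (l : C) T : pull (l *: T) = l *: pull T.
Proof. by apply: bop_ext => x; rewrite bopZE !pullE bopZE bopLZ. Qed.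
Lemma pull1 : pull 1 = 1.
Proof. by apply: bop_ext => x; rewrite pullE !bop1E unitaryK. Qed.
Lemma pull_adj T : adj (pull T) = pull (adj T).
Proof. by apply: adj_unique => x y; rewrite !pullE !(adjEr, adjK). Qed.
Lemma pull_projection T : projection T -> projection (pull T).
Proof. by move=> [TT Ta]; split; rewrite ?pull_adj -?pullM ?TT ?Ta. Qed.

End UnitaryConjugation.

Section Blocks.
Variable R : realType.
Local Notation C := R[i].
Variable K : hilbertType C.
Implicit Types x y z w : bop K K.

Lemma dsum_ext (u v : dsum K K) : u.1 = v.1 -> u.2 = v.2 -> u = v.
Proof. by case: u v => ? ? [? ?] /= -> ->. Qed.

Lemma dsum_addE (k l k' l' : K) :
  ((k, l) : dsum K K) + (k', l') = (k + k', l + l').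
Proof. by []. Qed.

Lemma dsum_scaleE (a : C) (k l : K) :
  a *: ((k, l) : dsum K K) = (a *: k, a *: l).
Proof. by []. Qed.

Lemma dsum_innerE (u v : dsum K K) : inner u v = inner u.1 v.1 + inner u.2 v.2.
Proof. by []. Qed.

Lemma block_ext (f g : bop (dsum K K) (dsum K K)) :
  (forall k l, f (k, l) = g (k, l)) -> f = g.
Proof. by move=> h; apply: bop_ext => -[k l]; exact: h. Qed.

Lemma blockM x y z w x' y' z' w' :
  block x y z w * block x' y' z' w' =
  block (x * x' + y * z') (x * y' + y * w') (z * x' + w * z') (z * y' + w * w').
Proof.
apply: block_ext => k l.
transitivity (block x y z w (x' k + y' l, z' k + w' l)).
  by rewrite bopME (blockE x' y' z' w' k l).
rewrite !blockE; apply: dsum_ext; cbn [fst snd];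
  by rewrite !(bopDE, bopME) !bopLD addrACA.
Qed.

Lemma blockD x y z w x' y' z' w' :
  block x y z w + block x' y' z' w' = block (x + x') (y + y') (z + z') (w + w').
Proof.
apply: block_ext => k l; rewrite bopDE !blockE dsum_addE !bopDE.
by congr (_, _); rewrite addrACA.
Qed.

Lemma blockZ (a : C) x y z w :
  a *: block x y z w = block (a *: x) (a *: y) (a *: z) (a *: w).
Proof.
apply: block_ext => k l; rewrite bopZE !blockE dsum_scaleE !bopZE.
by rewrite !scalerDr.
Qed.

Lemma block_inj x y z w x' y' z' w' :
  block x y z w = block x' y' z' w' -> [/\ x = x', y = y', z = z' & w = w'].
Proof.
move=> e.
have ek k l : ((x k + y l, z k + w l) : dsum K K) = (x' k + y' l, z' k + w' l).
  by rewrite -!blockE e.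
have ek1 k l : x k + y l = x' k + y' l by exact: (congr1 fst (ek k l)).
have ek2 k l : z k + w l = z' k + w' l by exact: (congr1 snd (ek k l)).
split; apply: bop_ext => k.
- by have := ek1 k 0; rewrite !bopL0 !addr0.
- by have := ek1 0 k; rewrite !bopL0 !add0r.
- by have := ek2 k 0; rewrite !bopL0 !addr0.
- by have := ek2 0 k; rewrite !bopL0 !add0r.
Qed.

Lemma block_all (X : bop (dsum K K) (dsum K K)) :
  exists x y z w, X = block x y z w.
Proof.
exists (dfst K K \bo X \bo dinl K K), (dfst K K \bo X \bo dinr K K),
  (dsnd K K \bo X \bo dinl K K), (dsnd K K \bo X \bo dinr K K).
apply: block_ext => k l; rewrite blockE !bcompE.
have -> : ((k, l) : dsum K K) = dinl K K k + dinr K K l.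
  by apply: dsum_ext; rewrite /= ?addr0 ?add0r.
by rewrite bopLD; apply: dsum_ext.
Qed.

Lemma block1 : block 1 0 0 1 = 1 :> bop (dsum K K) (dsum K K).
Proof.
apply: block_ext => k l; rewrite blockE bop1E.
by apply: dsum_ext; rewrite /= ?addr0 ?add0r.
Qed.

Lemma ampl_block v x y z w :
  ampl v * block x y z w = block (v * x) (v * y) (v * z) (v * w).
Proof. by rewrite /ampl blockM !mul0r !addr0 !add0r. Qed.

Lemma block_ampl v x y z w :
  block x y z w * ampl v = block (x * v) (y * v) (z * v) (w * v).
Proof. by rewrite /ampl blockM !mulr0 !addr0 !add0r. Qed.

Lemma amplM z w : ampl z * ampl w = ampl (z * w).
Proof. by rewrite {2}/ampl ampl_block !mulr0. Qed.

Lemma ampl_inj z w : ampl z = ampl w -> z = w.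
Proof. by case/block_inj. Qed.

Lemma amplE z k l : ampl z (k, l) = (z k, z l).
Proof. by rewrite /ampl blockE !bop0E addr0 add0r. Qed.

Lemma blockN x y z w : - block x y z w = block (- x) (- y) (- z) (- w).
Proof. by rewrite -scaleN1r blockZ !scaleN1r. Qed.

(** The matrix of [(1 + s)/2] when [2 s = E t - l g q t], with [z], [w] the corners
    of [E], [g], the symmetry [t] being [diag (1, -1)] and [q] the flip. *)
Lemma half_reflection_block (l : C) z w :
  4^-1 *: (1 + 1 + (ampl z * block 1 0 0 (-1)
    - l *: (ampl w * block 0 1 1 0 * block 1 0 0 (-1)))) =
  block (2^-1 *: (1 : bop K K) + 4^-1 *: z) ((l / 4) *: w)
        (- (l / 4) *: w) (2^-1 *: (1 : bop K K) - 4^-1 *: z).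
Proof.
have zE : ampl z * block 1 0 0 (-1) = block z 0 0 (- z).
  by rewrite ampl_block !mulr0 mulr1 mulrN1.
have wE : ampl w * block 0 1 1 0 * block 1 0 0 (-1) = block 0 (- w) w 0.
  by rewrite ampl_block blockM !mulr0 !mul0r !mulr1 !mulrN1 !addr0 !add0r.
rewrite zE wE -[in X in X + X + _]block1 blockZ blockN !blockD blockZ.
by congr block; apply: bop_inner_ext => h k;
  rewrite !bopE ?(innerZl, innerDl, innerNl, inner0l); field.
Qed.

(** The commutant of the diagonal matrices [z (+) z] is computed entrywise. *)
Lemma M2_commutant (S : set (bop K K)) (X : bop (dsum K K) (dsum K K)) :
  M2 (commutant S) X <-> (forall z, S z -> ampl z * X = X * ampl z).
Proof.
split=> [[x [y [w [v [xS yS wS vS ->]]]]] z Sz|h].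
  by rewrite ampl_block block_ampl xS// yS// wS// vS.
have [x [y [w [v XE]]]] := block_all X.
have hz z : S z -> [/\ z * x = x * z, z * y = y * z, z * w = w * z & z * v = v * z].
  by move=> /h; rewrite XE ampl_block block_ampl => /block_inj.
by exists x, y, w, v; split=> // z /hz[].
Qed.

End Blocks.

Section Halving.
Variable R : realType.
Local Notation C := R[i].
Variables (H : hilbertType C) (p q : bop H H).
Hypotheses (pP : projection p) (qa : adj q = q) (qq : q * q = 1).
Hypothesis qp : q * p = (1 - p) * q.

Local Notation K := (pspace p).
Let i : bop K H := pinc p.

Definition halving_unitary : bop (dsum K K) H :=
  i \bo dfst K K + (q \bo i) \bo dsnd K K.
Local Notation U := halving_unitary.

Let iK k : adj i (i k) = k. Proof. exact: pincK. Qed.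
Let pi k : p (i k) = i k. Proof. exact: pincP. Qed.

Lemma pinc_adjK h : i (adj i h) = p h.
Proof.
apply: inner_ext => k; rewrite -pi !(adjE p) pP.2.
have [l ->] : exists l, p k = i l by apply: pinc_surj; rewrite -bopME pP.1.
by rewrite pinc_inner -adjEr.
Qed.

Let qK h : q (q h) = h. Proof. by rewrite -bopME qq. Qed.

Let qpq h : p (q h) = q h - q (p h).
Proof. by rewrite -!bopME qp mulrDl mul1r mulNr !bopE opprB addrCA subrr addr0. Qed.

Let iq k : adj i (q (i k)) = 0.
Proof. by rewrite -[LHS]iK pinc_adjK qpq pi subrr bopL0. Qed.

Lemma halving_unitaryE k l : U (k, l) = i k + q (i l).
Proof. by []. Qed.

Lemma halving_unitary_adjE h : adj U h = (adj i h, adj i (q h)).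
Proof.
pose V := dinl K K \bo adj i + dinr K K \bo (adj i \bo q).
have VE h' : V h' = (adj i h', adj i (q h')).
  by apply: dsum_ext; rewrite /= ?addr0 ?add0r.
have -> : adj U = V; last exact: VE.
apply: adj_unique => -[k l] h'; rewrite VE halving_unitaryE innerDl dsum_innerE.
by cbn [fst snd]; rewrite (adjE q) qa !(adjE i).
Qed.

(* Otherwise the operator-evaluation rules would unfold it to a sum. *)
Opaque halving_unitary.

Lemma halving_unitaryP : unitary U.
Proof.
split; apply: bop_ext.
  case=> k l; rewrite bcompE halving_unitaryE halving_unitary_adjE !bopLD iK iq addr0.
  by rewrite iq add0r qK iK.
move=> h; rewrite bcompE halving_unitary_adjE halving_unitaryE !pinc_adjK qpq.
by rewrite bopLD bopLN !qK addrC subrK.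
Qed.
Let UP := halving_unitaryP.

Definition corner (T : bop H H) : bop K K := adj i \bo T \bo i.

Lemma corner_pinc T k : T * p = p * T -> i (corner T k) = T (i k).
Proof. by move=> Tp; rewrite /corner !bcompE pinc_adjK -bopME -Tp bopME pi. Qed.

(** Commuting with [p] makes the matrix of [T] diagonal, and commuting with [q]
    makes its two entries equal. *)
Lemma pull_corner T : T * p = p * T -> T * q = q * T ->
  pull U T = ampl (corner T).
Proof.
move=> Tp Tq; apply: block_ext => k l; rewrite pullE amplE halving_unitaryE.
rewrite bopLD -(bopME T q) Tq bopME -!(corner_pinc _ Tp).
by rewrite -halving_unitaryE unitaryK.
Qed.

Lemma pull_q : pull U q = block 0 1 1 0.
Proof.
apply: block_ext => k l; rewrite pullE halving_unitaryE blockE !bop0E !bop1E.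
by rewrite add0r addr0 bopLD qK addrC -halving_unitaryE unitaryK.
Qed.

Lemma pull_p : pull U p = block 1 0 0 0.
Proof.
apply: block_ext => k l; rewrite pullE halving_unitaryE blockE !bop0E !bop1E.
rewrite !addr0 bopLD qpq !pi subrr addr0.
have -> : i k = U (k, 0) by rewrite halving_unitaryE !bopL0 addr0.
by rewrite unitaryK.
Qed.

Lemma push_ampl_q z : push U (ampl z) * q = q * push U (ampl z).
Proof.
apply: (pull_inj UP); rewrite !pullM// pull_q pushK//.
by rewrite ampl_block block_ampl !mulr0 !mul0r mulr1 mul1r.
Qed.

Lemma push_ampl_p z : push U (ampl z) * p = p * push U (ampl z).
Proof.
apply: (pull_inj UP); rewrite !pullM// pull_p pushK//.
by rewrite ampl_block block_ampl !mulr0 !mul0r mulr1 mul1r.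
Qed.

Lemma push_corner T : T * p = p * T -> T * q = q * T ->
  push U (ampl (corner T)) = T.
Proof. by move=> Tp Tq; rewrite -pull_corner// pullK. Qed.

Lemma cornerM S T : T * p = p * T -> corner (S * T) = corner S * corner T.
Proof.
move=> Tp; apply: bop_ext => k; rewrite bopME.
have e : adj i (S (T (i k))) = adj i (S (i (corner T k))).
  by rewrite (corner_pinc k Tp).
exact: e.
Qed.

Lemma corner_adj T : adj (corner T) = corner (adj T).
Proof. by rewrite /corner !adj_comp adjK; exact: bop_ext. Qed.

Lemma corner_positive T : positive T -> positive (corner T).
Proof. by move=> Tp k; rewrite /corner !bcompE -adjEr; exact: Tp. Qed.

Lemma cornerD S T : corner (S + T) = corner S + corner T.
Proof. by apply: bop_ext => k; rewrite /corner !bopE bopLD. Qed.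

Lemma cornerN T : corner (- T) = - corner T.
Proof. by apply: bop_ext => k; rewrite /corner !bopE bopLN. Qed.

Lemma corner1 : corner 1 = 1.
Proof. by apply: bop_ext => k; rewrite /corner !bopE iK. Qed.

End Halving.

(** * Symmetries attached to an absolutely compatible pair *)

Section Decomposition.
Variable R : realType.
Local Notation C := R[i].
Implicit Types H K L : hilbertType C.

(** Membership of [T] in the double commutant of [a] and [b], in curried form. *)
Definition in_bicommutant H (a b T : bop H H) :=
  forall z, z * a = a * z -> z * b = b * z -> z * T = T * z.

Definition injective_op H (T : bop H H) := forall h, T h = 0 -> h = 0.

Lemma half_fst H (a b : bop H H) : a = 2^-1 *: (1 + (a - b) - (1 - a - b)).
Proof.
apply: bop_inner_ext => h k; rewrite !bopE innerZl !(innerDl, innerNl).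
by field.
Qed.

Lemma half_snd H (a b : bop H H) : b = 2^-1 *: (1 - (a - b) - (1 - a - b)).
Proof.
apply: bop_inner_ext => h k; rewrite !bopE innerZl !(innerDl, innerNl).
by field.
Qed.

(** [|y| = 1 - c] commutes with [y] and [c] with [x], so [c] commutes with both.
    At a joint eigenvector [s h = e h], [t h = f h] with [e], [f] equal to 1 or -1,
    the formulas for [a] and [b] give [b h = 0], [a h = 0], [a h = h] or [b h = h]
    according to the signs. *)
Lemma abs_compat_decomposition H (M : set (bop H H)) (a b : bop H H) :
  von_neumann M -> effect M a -> effect M b -> strict M a -> strict M b ->
  absolutely_compatible a b ->
  exists c s t : bop H H,
    [/\ [/\ positive c, positive (1 - c), injective_op c & injective_op (1 - c)],
        [/\ adj s = s, s * s = 1, adj t = t & t * t = 1],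
        a - b = c * s /\ 1 - a - b = (1 - c) * t,
        [/\ in_bicommutant a b c, in_bicommutant a b s,
            in_bicommutant a b t, c * a = a * c & c * b = b * c] &
        forall (e f : C) h, e * e = 1 -> f * f = 1 ->
          s h = e *: h -> t h = f *: h -> h = 0].
Proof.
move=> Mv aE bE /(strictP Mv aE)[a0 a1] /(strictP Mv bE)[b0 b1] ac.
have aa := effect_selfadj aE; have ba := effect_selfadj bE.
have xa : adj (a - b) = a - b by rewrite adjD adjN aa ba.
have ya : adj (1 - a - b) = 1 - a - b by rewrite !adjD !adjN adj1 aa ba.
have [cp cc cT] := oabsP xa; have [dp dd dT] := oabsP ya.
have dE : oabs (1 - a - b) = 1 - oabs (a - b) 
    by apply: (@addrI _ (oabs (a - b))); rewrite ac addrCA subrr addr0.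
rewrite dE in dp dd dT; set c := oabs (a - b) in cp cc cT dE dp dd dT *.
have ca := positive_selfadj cp; have da := positive_selfadj dp.
have xc : (a - b) * c = c * (a - b) by apply: cT; rewrite mulrA.
have yd : (1 - a - b) * (1 - c) = (1 - c) * (1 - a - b).
  by apply: dT; rewrite mulrA.
have yc : (1 - a - b) * c = c * (1 - a - b).
  have -> : c = 1 - (1 - c) by rewrite opprB addrC subrK.
  by apply: commuteD; [exact: commute1|exact: commuteN].
have cA : c * a = a * c.
  rewrite (half_fst a b); apply: commuteZ; apply: commuteD.
    by apply: commuteD; [exact: commute1|exact: esym].
  exact/commuteN/esym.
have cB : c * b = b * c.
  rewrite (half_snd a b); apply: commuteZ; apply: commuteD.
    by apply: commuteD; [exact: commute1|exact/commuteN/esym].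
  exact/commuteN/esym.
have c0 : injective_op c by exact: (abs_compat_ker xa a0 a1).
have d0 : injective_op (1 - c).
  have e1 : a - (1 - b) = - (1 - a - b) by opring.
  have e2 : 1 - a - (1 - b) = - (a - b) by opring.
  apply: (@abs_compat_ker _ _ a (1 - b)) => //.
  - by rewrite e1 adjN ya.
  - by rewrite mulrBl mulrBr mul1r mulr1 cA.
  - by rewrite e1 mulrNN.
  - by rewrite e2 mulrNN opprB addrC subrK.
have [s [sa ss xE sc]] := signP xa ca xc (esym cc) c0.
have [t [ta tt yE tc]] := signP ya da yd (esym dd) d0.
have Zx : in_bicommutant a b (a - b).
  by move=> z za zb; apply: commuteD => //; exact: commuteN.
have Zy : in_bicommutant a b (1 - a - b).
  move=> z za zb; apply: commuteD; last exact: commuteN.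
  by apply: commuteD; [exact: commute1|exact: commuteN].
have Zc : in_bicommutant a b c.
  by move=> z za zb; apply: cT; apply: commuteM; exact: Zx.
have Zd : in_bicommutant a b (1 - c).
  by move=> z za zb; apply: dT; apply: commuteM; exact: Zy.
exists c, s, t; split=> //.
  split=> // z za zb.
    by apply: sc; [exact: Zx|exact: Zc].
  by apply: tc; [exact: Zy|exact: Zd].
move=> e f h ee ff sh th.
have xh : (a - b) h = e *: c h by rewrite xE bopME sh bopLZ.
have yh : (1 - a - b) h = f *: (h - c h) by rewrite yE bopME th bopLZ !bopE.
have ah : a h = 2^-1 *: (h + e *: c h - f *: (h - c h)).
  by rewrite {1}(half_fst a b) bopZE bopDE bopDE bop1E bopNE xh yh.
have bh : b h = 2^-1 *: (h - e *: c h - f *: (h - c h)).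
  by rewrite {1}(half_snd a b) bopZE bopDE bopDE bop1E !bopNE xh yh.
have : (e == 1) || (e == -1) by rewrite -sqrf_eq1 expr2 ee.
have : (f == 1) || (f == -1) by rewrite -sqrf_eq1 expr2 ff.
clear xh yh; case/orP=> /eqP fE; case/orP=> /eqP eE.
- by apply: b0; rewrite bh eE fE; vring.
- by apply: a0; rewrite ah eE fE; vring.
- by apply: a1; rewrite ah eE fE; apply: inner_ext => k;
    rewrite innerZl !(innerDl, innerNl, innerZl); field.
- by apply: b1; rewrite bh eE fE; apply: inner_ext => k;
    rewrite innerZl !(innerDl, innerNl, innerZl); field.
Qed.

End Decomposition.

(** * Matrix form of the generated algebra *)

Section MatrixForm.
Variable R : realType.
Local Notation C := R[i].
(** The data produced by [abs_compat_decomposition] and [two_symmetries]. *)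
Variables (H : hilbertType C) (a b c s t g q : bop H H).
Local Notation Z := (in_bicommutant a b).
Let E := s * t + t * s.
Let p : bop H H := 2^-1 *: (1 + t).

Hypotheses (cp : positive c) (dp : positive (1 - c)).
Hypotheses (c0 : injective_op c) (d0 : injective_op (1 - c)).
Hypotheses (sa : adj s = s) (ss : s * s = 1) (ta : adj t = t) (tt : t * t = 1).
Hypotheses (xE : a - b = c * s) (yE : 1 - a - b = (1 - c) * t).
Hypotheses (Zc : Z c) (Zs : Z s) (Zt : Z t).
Hypotheses (ca : c * a = a * c) (cb : c * b = b * c).
Hypotheses (ga : adj g = g) (gg : g * g = 4 *: (1 : bop H H) - E * E).
Hypothesis (g0 : injective_op g).
Hypotheses (qa : adj q = q) (qq : q * q = 1) (qt : q * t = - (t * q)).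
Hypothesis ssE : s + s = E * t - 'i%C *: (g * q * t).
Hypothesis gE : forall T, T * E = E * T -> T * g = g * T.
Hypothesis Zst : forall T, T * s = s * T -> T * t = t * T -> T * q = q * T.

Lemma commuteE (T : bop H H) : T * s = s * T -> T * t = t * T -> T * E = E * T.
Proof. by move=> Ts Tt; apply: commuteD; exact: commuteM. Qed.

Lemma q_bicommutant : Z q.
Proof. by move=> z za zb; apply: Zst; [exact: Zs|exact: Zt]. Qed.
Lemma p_bicommutant : Z p.
Proof.
move=> z za zb; apply: commuteZ; apply: commuteD; first exact: commute1.
exact: Zt.
Qed.
Lemma E_bicommutant : Z E.
Proof. by move=> z za zb; apply: commuteE; [exact: Zs|exact: Zt]. Qed.

Lemma p_projection : projection p.
Proof.
split; last by rewrite adjZ half_conj adjD adj1 ta.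
rewrite /p bopZAl bopZAr mulrDl !mulrDr tt mulr1 mul1r.
apply: bop_inner_ext => h k; rewrite !bopE !innerZl !(innerDl, innerNl).
by field.
Qed.

Lemma q_swaps_p : q * p = (1 - p) * q.
Proof.
rewrite /p mulrBl mul1r bopZAl bopZAr mulrDl mulrDr mulr1 mul1r qt.
apply: bop_inner_ext => h k.
by rewrite !bopE ?(bopLD, bopLN, bopLZ) ?(innerDl, innerZl, innerNl); field.
Qed.

Lemma commute_with_ab T : T * c = c * T -> T * s = s * T -> T * t = t * T ->
  T * a = a * T /\ T * b = b * T.
Proof.
move=> Tc Ts Tt.
have Tx : T * (a - b) = (a - b) * T by rewrite xE; exact: commuteM.
have Ty : T * (1 - a - b) = (1 - a - b) * T.
  rewrite yE; apply: commuteM => //; apply: commuteD; first exact: commute1.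
  exact: commuteN.
split; [rewrite (half_fst a b)|rewrite (half_snd a b)]; apply: commuteZ;
  apply: commuteD; try exact: commuteN; apply: commuteD => //;
  by [exact: commute1|exact: commuteN].
Qed.

Lemma commute_c T : Z T -> T * c = c * T.
Proof. by move=> ZT; rewrite ZT. Qed.

Lemma s_comm_E : s * E = E * s.
Proof. by rewrite /E mulrDr mulrDl -!mulrA ss !mulrA ss mulr1 mul1r addrC. Qed.
Lemma t_comm_E : t * E = E * t.
Proof. by rewrite /E mulrDr mulrDl -!mulrA tt !mulrA tt mulr1 mul1r addrC. Qed.

Lemma E_ab : E * a = a * E /\ E * b = b * E.
Proof. by apply: commute_with_ab; [exact/commute_c/E_bicommutant|rewrite s_comm_E|rewrite t_comm_E]. Qed.
Lemma g_ab : g * a = a * g /\ g * b = b * g.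
Proof.
apply: commute_with_ab; apply: esym; apply: gE; [|exact: s_comm_E|exact: t_comm_E].
exact: E_bicommutant.
Qed.

Local Notation K := (pspace p).
Let U : bop (dsum K K) H := halving_unitary p q.
Lemma U_unitary : unitary U. Proof. exact: halving_unitaryP p_projection qa qq q_swaps_p. Qed.

Let x0 : bop K K := corner p c.
Let e : bop K K := corner p E.
Let f : bop K K := corner p g.
(** The von Neumann algebra of functions of the commuting pair [x0], [e]. *)
Definition coefficient_algebra := commutant (commutant [set x0; e]).
Local Notation M0 := coefficient_algebra.

Lemma c_comm_pq : c * p = p * c /\ c * q = q * c.
Proof. by split; [exact: p_bicommutant|exact: q_bicommutant]. Qed.
Lemma E_comm_pq : E * p = p * E /\ E * q = q * E.
Proof. by have [hEa hEb] := E_ab; split; [exact: p_bicommutant|exact: q_bicommutant]. Qed.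
Lemma g_comm_pq : g * p = p * g /\ g * q = q * g.
Proof. by have [hga hgb] := g_ab; split; [exact: p_bicommutant|exact: q_bicommutant]. Qed.

Lemma x0_selfadj : adj x0 = x0.
Proof. by rewrite corner_adj positive_selfadj. Qed.
Lemma E_selfadj : adj E = E. Proof. by rewrite adjD !adjM sa ta addrC. Qed.
Lemma e_selfadj : adj e = e. Proof. by rewrite corner_adj E_selfadj. Qed.

Lemma generators_star : star_closed [set x0; e].
Proof. by move=> z [->|->]; [left; rewrite x0_selfadj|right; rewrite e_selfadj]. Qed.

Lemma x0_e_commute : x0 * e = e * x0.
Proof.
rewrite -(cornerM p_projection c E_comm_pq.1) -(cornerM p_projection E c_comm_pq.1).
by rewrite commute_c//; exact: E_bicommutant.
Qed.

Lemma M0_von_neumann : von_neumann M0.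
Proof. exact/bicommutant_von_neumann/generators_star. Qed.

Lemma M0_abelian : abelian M0.
Proof.
by apply: bicommutant_abelian => z w [->|->] [->|->] //; rewrite x0_e_commute.
Qed.

Lemma M0_x0 : M0 x0. Proof. by apply: sub_bicommutant; left. Qed.
Lemma M0_e : M0 e. Proof. by apply: sub_bicommutant; right. Qed.

Lemma pull_swap : pull U q = block 0 1 1 0.
Proof. exact: pull_q p_projection qa qq q_swaps_p. Qed.
Lemma pull_half : pull U p = block 1 0 0 0.
Proof. exact: pull_p p_projection qa qq q_swaps_p. Qed.
Lemma pull_corner_pq (T : bop H H) : T * p = p * T /\ T * q = q * T ->
  pull U T = ampl (corner p T).
Proof. by move=> [Tp Tq]; exact: pull_corner p_projection qa qq q_swaps_p _ Tp Tq. Qed.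

Lemma push_commute (z : bop K K) (T : bop H H) :
  T * p = p * T /\ T * q = q * T -> z * corner p T = corner p T * z ->
  push U (ampl z) * T = T * push U (ampl z).
Proof.
move=> Tpq zT; apply: (pull_inj U_unitary).
by rewrite !(pullM U_unitary) (pushK U_unitary) pull_corner_pq// !amplM zT.
Qed.

(** The corner of [g] is a function of [e]: an operator commuting with [e] commutes
    with [E] once transported to [H], hence with [g]. *)
Lemma push_E_g (z : bop K K) : z * e = e * z ->
  push U (ampl z) * g = g * push U (ampl z).
Proof. by move=> ze; apply: gE; exact: (push_commute E_comm_pq). Qed.

Lemma M0_off_diagonal : M0 f.
Proof.
move=> z zS; have ze : z * e = e * z by rewrite zS//; right.
apply: ampl_inj; rewrite -!amplM -(pull_corner_pq g_comm_pq) -{1 2}(pushK U_unitary (ampl z)).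
by rewrite -!(pullM U_unitary) push_E_g.
Qed.

(** Everything commuting with [a] and [b] commutes with [p], [q], [c], [E], so it is
    [z (+) z] with [z] commuting with the corners of [c] and [E].  Conversely such a
    matrix commutes with [c], [E], [g], [p], [q], hence with [t], [s] and finally
    with [a] and [b]. *)
Lemma commutant_ab T : commutant [set a; b] T <->
  exists2 z, commutant [set x0; e] z & T = push U (ampl z).
Proof.
split=> [Tab|[z zS ->]].
  have Ta : T * a = a * T by rewrite Tab//; left.
  have Tb : T * b = b * T by rewrite Tab//; right.
  have Tp := p_bicommutant Ta Tb; have Tq := q_bicommutant Ta Tb.
  exists (corner p T); last by rewrite (push_corner p_projection qa qq q_swaps_p).
  move=> _ [->|->].
  - by rewrite -(cornerM p_projection c Tp) -(cornerM p_projection T c_comm_pq.1) Zc.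
  - by rewrite -(cornerM p_projection E Tp) -(cornerM p_projection T E_comm_pq.1) E_bicommutant.
have zx : z * x0 = x0 * z by rewrite zS//; left.
have ze : z * e = e * z by rewrite zS//; right.
have Lc := push_commute c_comm_pq zx; have LE := push_commute E_comm_pq ze.
have Lg := push_E_g ze.
have Lp := push_ampl_p p_projection qa qq q_swaps_p z; have Lq := push_ampl_q p_projection qa qq q_swaps_p z.
rewrite -/U in Lp Lq; set L := push U _ in Lc LE Lg Lp Lq *.
have tp : t = p + p - 1.
  apply: bop_inner_ext => h k; rewrite !bopE !innerDl !innerNl !innerZl !innerDl.
  by field.
have Lt : L * t = t * L.
  rewrite tp; apply: commuteD; first exact: commuteD.
  exact/commuteN/commute1.
have Ls : L * s = s * L.
  have -> : s = 2^-1 *: (s + s).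
    by apply: bop_inner_ext => h k; rewrite !bopE innerZl innerDl; field.
  rewrite ssE; apply: commuteZ; apply: commuteD; first exact: commuteM.
  by apply: commuteN; apply: commuteZ; apply: commuteM => //; exact: commuteM.
have [La Lb] := commute_with_ab Lc Ls Lt.
by move=> _ [->|->].
Qed.

Lemma generated_algebraE :
  [set pull U T | T in commutant (commutant [set a; b])] = M2 M0.
Proof.
rewrite eqEsubset; split=> [_ [T T2 <-]|X XM].
  apply/M2_commutant => z zS.
  have /T2 LT : commutant [set a; b] (push U (ampl z)).
    by apply/commutant_ab; exists z.
  by rewrite -{1 2}(pushK U_unitary (ampl z)) -!(pullM U_unitary) LT.
have XE := pushK U_unitary X.
exists (push U X) => // w /commutant_ab[z zS ->].
apply: (pull_inj U_unitary); rewrite !(pullM U_unitary) !(pushK U_unitary).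
by move/M2_commutant: XM; exact.
Qed.

Let sigma : bop H H := 2^-1 *: (1 + s).
Definition strict_proj := pull U sigma.
Local Notation P := strict_proj.
Let p1 : bop K K := 2^-1 *: (1 : bop K K) + 4^-1 *: e.
Let p2 : bop K K := 2^-1 *: (1 : bop K K) - 4^-1 *: e.
Let r : bop K K := ('i%C / 4) *: f.

Lemma r_adj : adj r = (- ('i%C / 4)) *: f.
Proof.
rewrite adjZ corner_adj ga; congr (_ *: _).
by rewrite rmorphM/= imagC fmorphV rmorph_nat mulNr.
Qed.

Lemma strict_projE : P = block p1 r (adj r) p2.
Proof.
have sigmaE : sigma = 4^-1 *: (1 + 1 + (E * t - 'i%C *: (g * q * t))).
  rewrite -ssE; apply: bop_inner_ext => h k.
  by rewrite !bopE !innerZl !innerDl; field.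
have tp : t = p + p - 1.
  apply: bop_inner_ext => h k; rewrite !bopE !innerDl !innerNl !innerZl !innerDl.
  by field.
have tU : pull U t = block 1 0 0 (-1).
  rewrite tp 2!pullD pullN (pull1 U_unitary) pull_half -block1 blockN 2!blockD.
  by rewrite !oppr0 !addr0 add0r addrK.
rewrite /P sigmaE pullZ 3!pullD pullN pullZ 3!(pullM U_unitary) (pull1 U_unitary) tU pull_swap.
by rewrite (pull_corner_pq E_comm_pq) (pull_corner_pq g_comm_pq) half_reflection_block r_adj.
Qed.

Lemma sigma_projection : projection sigma.
Proof.
split; last by rewrite adjZ half_conj adjD adj1 sa.
rewrite /sigma bopZAl bopZAr mulrDl !mulrDr ss mulr1 mul1r.
apply: bop_inner_ext => h k; rewrite !bopE !innerZl !(innerDl, innerNl).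
by field.
Qed.

Lemma strict_proj_projection : projection P.
Proof. by apply: (pull_projection U_unitary); exact: sigma_projection. Qed.

Lemma pinc_inj (k : K) : pinc p k = 0 -> k = 0.
Proof. by move=> k0; rewrite -(pincK k) k0 bopL0. Qed.

(** An eigenvector of [e] for the eigenvalue 2 or -2 would be killed by
    [4 - E^2 = g^2]; this is where generic position makes the projection strict. *)
Lemma e_no_eigenvector (l : C) k : l * l = 4 -> e k = l *: k -> k = 0.
Proof.
move=> ll ek; apply: pinc_inj; set h := pinc p k.
have Eh : E h = l *: h.
  by rewrite -(corner_pinc p_projection _ E_comm_pq.1) -/e ek bopLZ.
apply: (g0); apply: (g0); rewrite -bopME gg bopDE bopZE bop1E bopNE (bopME E E h).
by rewrite Eh bopLZ Eh scalerA ll subrr.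
Qed.

Lemma M0_linear (l : C) y w : M0 y -> M0 w -> M0 (l *: y + w).
Proof. by case: M0_von_neumann => -[_ h _ _] _; exact: h. Qed.
Lemma M0_1 : M0 1.
Proof. by case: M0_von_neumann => -[]. Qed.
Lemma M0_0 : M0 0.
Proof. by rewrite -(addNr (1 : bop K K)) -scaleN1r; apply: M0_linear; exact: M0_1. Qed.
Lemma M0_Z (l : C) y : M0 y -> M0 (l *: y).
Proof. by move=> My; rewrite -[_ *: _]addr0; apply: M0_linear => //; exact: M0_0. Qed.

Lemma p1_add_p2 : p1 + p2 = 1.
Proof.
apply: bop_inner_ext => h k; rewrite !bopE !(innerDl, innerNl, innerZl).
by field.
Qed.

(** [p1] and [1 - p1] are the diagonal corners of a projection. *)
Lemma p1_effect : effect M0 p1.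
Proof.
have PP := projection_positive strict_proj_projection.
split.
- by apply: M0_linear; [exact: M0_1|apply: M0_Z; exact: M0_e].
- move=> k; rewrite !bopDE bopNE bop0E subr0.
  have := PP (k, 0); rewrite strict_projE blockE dsum_innerE; cbn [fst snd].
  by rewrite inner0r !bopL0 !addr0.
move=> k; have -> : 1 - p1 = p2 by rewrite -p1_add_p2 addrC addKr.
have := PP (0, k); rewrite strict_projE blockE dsum_innerE; cbn [fst snd].
by rewrite inner0r !bopL0 !add0r.
Qed.

Lemma p1_strict : strict M0 p1.
Proof.
apply/(strictP M0_von_neumann p1_effect); split=> k p1k.
  apply: (@e_no_eigenvector (-2)); first by rewrite mulrNN -natrM.
  have -> : e k = 4 *: p1 k - 2 *: k.
    by apply: inner_ext => l; rewrite !bopE !(innerDl, innerNl, innerZl); field.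
  by rewrite p1k scaler0 sub0r scaleNr.
apply: (@e_no_eigenvector 2); first by rewrite -natrM.
have -> : e k = 4 *: p1 k - 2 *: k.
  by apply: inner_ext => l; rewrite !bopE !(innerDl, innerNl, innerZl); field.
by rewrite p1k -scalerBl; congr (_ *: _); ring.
Qed.

Lemma strict_projP : strict_projection M0 P.
Proof.
split; first exact: strict_proj_projection.
exists p1, r, p2; split; [exact: strict_projE| | exact: p1_effect | exact: p1_strict | exact: p1_add_p2].
split.
- by apply: M0_linear; [exact: M0_1|apply: M0_Z; exact: M0_e].
- by apply: M0_Z; exact: M0_off_diagonal.
- rewrite /p2 -scaleNr.
  by apply: M0_linear; [exact: M0_1|apply: M0_Z; exact: M0_e].
Qed.

Lemma x0_effect : effect M0 x0.
Proof.
split; first exact: M0_x0.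
  by move=> k; rewrite subr0; exact: corner_positive.
rewrite /ople -(corner1 p) -cornerN -cornerD.
exact: corner_positive.
Qed.

Lemma x0_strict : strict M0 x0.
Proof.
apply/(strictP M0_von_neumann x0_effect); split=> k xk; apply: pinc_inj.
  by apply: c0; rewrite -(corner_pinc p_projection _ c_comm_pq.1) -/x0 xk bopL0.
apply: d0; rewrite !bopE -(corner_pinc p_projection _ c_comm_pq.1) -/x0 xk.
exact: subrr.
Qed.

Lemma pull_1Bc : pull U (1 - c) = ampl (1 - x0).
Proof.
rewrite pull_corner_pq; first by rewrite cornerD cornerN (corner1 p).
have [cp' cq'] := c_comm_pq.
by rewrite !mulrBl !mulrBr !mul1r !mulr1 cp' cq'.
Qed.

Lemma pull_1Bp : pull U (1 - p) = block 0 0 0 1.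
Proof.
rewrite pullD pullN (pull1 U_unitary) pull_half -block1 blockN blockD.
by rewrite !oppr0 !addr0 subrr.
Qed.

Lemma pull_aE : pull U a = ampl (1 - x0) * block 0 0 0 1 + ampl x0 * P.
Proof.
rewrite -pull_1Bc -pull_1Bp -(pull_corner_pq c_comm_pq) -!(pullM U_unitary) -pullD; congr pull.
have -> : (1 - c) * (1 - p) + c * sigma = 2^-1 *: (1 + c * s - (1 - c) * t).
  rewrite /p /sigma; apply: bop_inner_ext => h k.
  by rewrite !bopE ?(bopLD, bopLN, bopLZ) ?(innerDl, innerZl, innerNl); field.
by rewrite -xE -yE -half_fst.
Qed.

Lemma pull_bE : pull U b =
  ampl (1 - x0) * block 0 0 0 1 + ampl x0 * (ampl 1 - P).
Proof.
have -> : ampl (1 : bop K K) = pull U 1 by rewrite (pull1 U_unitary) /ampl block1.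
rewrite -pull_1Bc -pull_1Bp -(pull_corner_pq c_comm_pq) -pullN -pullD -!(pullM U_unitary) -pullD.
congr pull.
have -> : (1 - c) * (1 - p) + c * (1 - sigma) = 2^-1 *: (1 - c * s - (1 - c) * t).
  rewrite /p /sigma; apply: bop_inner_ext => h k.
  by rewrite !bopE ?(bopLD, bopLN, bopLZ) ?(innerDl, innerZl, innerNl); field.
by rewrite -xE -yE -half_snd.
Qed.

End MatrixForm.

(** * The canonical form *)

Lemma commutant_mem (R : realType) (H : hilbertType R[i]) (M : set (bop H H))
    (a b T : bop H H) :
  von_neumann M -> M a -> M b -> in_bicommutant a b T -> M T.
Proof.
move=> Mv Ma Mb ZT; apply: von_neumann_mem => // y yM.
by apply: ZT; rewrite yM.
Qed.

(** The partial isometry is [q p], which maps [pH] onto the complement. *)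
Lemma halving_of_symmetry (R : realType) (H : hilbertType R[i])
    (M : set (bop H H)) (p q : bop H H) :
  von_neumann M -> M p -> M q -> projection p -> adj q = q -> q * q = 1 ->
  q * p = (1 - p) * q -> halving_projection M p.
Proof.
move=> [[_ _ MM _] _] Mp Mq p_projection qa qq q_swaps_p; split=> //.
have uu : adj (q * p) * (q * p) = p.
  by rewrite adjM p_projection.2 qa mulrA -(mulrA p q q) qq mulr1 p_projection.1.
exists (q * p); first exact: MM.
split; rewrite /partial_isometry ?uu//.
by rewrite adjM p_projection.2 qa mulrA -(mulrA q p p) p_projection.1 q_swaps_p -mulrA qq mulr1.
Qed.

Theorem theorem1p4 (R : realType) (H : hilbertType R[i])
    (M : set (bop H H)) (a b : bop H H) :
  von_neumann M ->
  effect M a -> effect M b ->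
  strict M a -> strict M b ->
  absolutely_compatible a b ->
  let M1 := vN_generated M [set a; b] in
  exists p : bop H H, halving_projection M p /\
  let K := pspace p in
  exists (U0 : bop (dsum K K) H) (M0 : set (bop K K)),
    [/\ unitary U0, von_neumann M0, abelian M0,
        star_isomorphic [set adj U0 \bo x \bo U0 | x in M1] (M2 M0) &
        exists (P : bop (dsum K K) (dsum K K)) (x0 : bop K K),
          let I2 := ampl (1 : bop K K) in
          let P0 := block 0 0 0 (1 : bop K K) in
          let P' := I2 - P in
          [/\ strict_projection M0 P,
              effect M0 x0, strict M0 x0,
              adj U0 \bo a \bo U0 = ampl (1 - x0) * P0 + ampl x0 * P &
              adj U0 \bo b \bo U0 = ampl (1 - x0) * P0 + ampl x0 * P']].
Proof.
move=> Mv aE bE aS bS ac M1.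
have [c [s [t [[cp dp c0 d0] [sa ss ta tt] [xE yE] [Zc Zs Zt ca cb] nje]]]] :=
  abs_compat_decomposition Mv aE bE aS bS ac.
have [g [q [[ga gg g0] [qa qq qt] ssE gE Zst]]] := two_symmetries sa ss ta tt nje.
have Ma : M a by case: aE.
have Mb : M b by case: bE.
have p_projection' := p_projection ta tt; have q_swaps_p' := q_swaps_p qt.
exists (2^-1 *: (1 + t)); split.
  apply: (halving_of_symmetry Mv (q := q)) => //.
    by apply: (commutant_mem Mv Ma Mb); exact: p_bicommutant Zt.
  by apply: (commutant_mem Mv Ma Mb); exact: q_bicommutant Zs Zt Zst.
exists (halving_unitary (2^-1 *: (1 + t)) q), (@coefficient_algebra _ _ c s t).
split.
- exact: U_unitary.
- exact: M0_von_neumann.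
- exact: (M0_abelian ss ta tt xE yE Zs Zt ca cb Zst).
- have -> : M1 = commutant (commutant [set a; b]).
    apply: vN_generatedE => //; first by move=> _ [->|->].
    move=> _ [->|->]; first by left; exact: effect_selfadj aE.
    by right; exact: effect_selfadj bE.
  have AE := generated_algebraE ss ta tt xE yE Zc Zs Zt ca cb qa qq qt ssE gE Zst.
  rewrite [X in star_isomorphic X _]AE.
  exists id; split=> //; split=> // T MT; by exists T.
exists (@strict_proj _ _ s t q), (corner _ c); split.
- exact: (strict_projP cp sa ss ta tt xE yE Zs Zt ca cb ga gg g0 qa qq qt ssE gE Zst).
- exact: (x0_effect s t cp dp).
- exact: (x0_strict cp dp c0 d0 sa ta tt Zs Zt ca cb Zst).
- exact: (pull_aE ta tt xE yE Zs Zt ca cb qa qq qt Zst).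
exact: (pull_bE ta tt xE yE Zs Zt ca cb qa qq qt Zst).
Qed.
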